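(* Fix an integer $N\ge1$ and let $S$ be a 2-string with $|S|=2N$. Then $$F_S(x_1,\dots,x_N;\bm{z})=\sum_{\sigma\in\mathfrak{M}_2(N,S)}\ \prod_{1\le i<j\le N}\Delta_{\sigma(i),\sigma(j)}(x_i,x_j;\bm{z})\ \prod_{i=1}^{N}F_{\sigma(i)}(x_i;\bm{z}),$$ where $\sigma(i)$ is the $i$-th row of $\sigma$, $F_{\sigma(i)}(x_i;\bm{z})$ is the single-variable ($N=1$) case of $F$ indexed by the 2-string $\sigma(i)$, and $\Delta_{U,V}(x,y;\bm{z})$ is defined as follows. Let $U,V$ be 2-strings with $|U|=|V|=2$, and let $e_a$ denote the string with a single 1 at position $a$ and zeros elsewhere (so each of $U,V$ is of the form $2e_a$ or $e_a+e_b$ with $a<b$). (i) If every nonzero entry of $U$ occurs strictly before every nonzero entry of $V$: $\Delta_{U,V}=\dfrac{(y-q^2x)(y-q^3x)}{(y-x)(y-qx)}$. (ii) If $U=e_a+e_b$ and either $V=2e_c$ with $a<c<b$, or $V=e_c+e_d$ with $a<c<d<b$: $\Delta_{U,V}=\dfrac{(y-q^2x)(q^2y-x)}{(y-x)^2}$. (iii) If $U=e_a+e_b$, $V=e_c+e_d$ with $a<c<b<d$: $\Delta_{U,V}=\dfrac{(y-q^2x)^2(x-qy)}{(y-x)^2(y-qx)}$. (iv) If $U=e_k+e_b$, $V=e_k+e_d$ with $k<b<d$: $\Delta_{U,V}=\dfrac{(q^2x-y)(xy+q^2xy-q^3yz_k-q^3xz_k)}{q(1-q)(y-x)(y-qx)z_k}$.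 (v) If $U=e_a+e_k$, $V=e_k+e_d$ with $a<k<d$: $\Delta_{U,V}=\dfrac{(y-q^2x)(xy+q^2xy-q^2yz_k-q^3xz_k)}{q(1-q)(y-x)^2z_k}$. (vi) If $U=e_a+e_k$, $V=e_c+e_k$ with $a<c<k$: $\Delta_{U,V}=\dfrac{(q^2x-y)(xy+q^2xy-q^2yz_k-q^2xz_k)}{(1-q)(y-x)(y-qx)z_k}$. (vii) If $U=V=e_k+e_\ell$ with $k<\ell$: $\Delta_{U,V}=\dfrac{(xy+q^2xy-q^3yz_k-q^3xz_k)(xy+q^2xy-q^2yz_\ell-q^2xz_\ell)}{q(1-q)^2(y-qx)(x-qy)z_kz_\ell}$. (viii) Every remaining case (that can occur for two rows of a matrix in $\mathfrak{M}_2(N,S)$) is determined by the symmetry $\Delta_{U,V}(x,y;\bm{z})=\Delta_{V,U}(y,x;\bm{z})$.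
   Context: **Weights.** All parameters ($q$ and the spectral parameters) are generic/indeterminates; all identities are between rational functions. For $i,j,k,\ell\in\{0,1,2\}$ the Izergin--Korepin vertex weight $W_{y/x}(i,j;k,\ell)$ ($i$ = bottom incoming state, $j$ = left incoming state, $k$ = top outgoing state, $\ell$ = right outgoing state; $x$ = parameter of the horizontal line, $y$ = parameter of the vertical line) depends on $x,y$ only through $y/x$, and, with $D=(x-q^2y)(x-q^3y)$, is given by $W(0,0;0,0)=W(2,2;2,2)=1$; $W(1,0;1,0)=W(2,1;2,1)=\frac{q^2(x-y)}{x-q^2y}$; $W(1,0;0,1)=W(2,1;1,2)=\frac{(1-q^2)x}{x-q^2y}$; $W(0,1;1,0)=W(1,2;2,1)=\frac{(1-q^2)y}{x-q^2y}$; $W(0,1;0,1)=W(1,2;1,2)=\frac{x-y}{x-q^2y}$; $W(2,0;2,0)=\frac{q^4(x-y)(x-qy)}{D}$; $W(2,0;1,1)=-\frac{q(1-q)^2(1+q)x(x-y)}{D}$; $W(2,0;0,2)=\frac{(1-q^2)x(x+qx-qy-q^3y)}{D}$; $W(1,1;2,0)=-\frac{q^4(1+q)(x-y)y}{D}$; $W(1,1;1,1)=\frac{-qx^2+(1+q)(1-q^2+q^4)xy-q^4y^2}{D}$; $W(1,1;0,2)=\frac{(1+q)x(x-y)}{D}$; $W(0,2;2,0)=\frac{(1-q^2)(x+q^2x-q^2y-q^3y)y}{D}$; $W(0,2;1,1)=\frac{q(1-q)^2(1+q)(x-y)y}{D}$; $W(0,2;0,2)=\frac{(x-y)(x-qy)}{D}$;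 and $W=0$ in all other cases. **2-strings.** A 2-string is an infinite vector $S=(S_1,S_2,\dots)$ with $S_i\in\{0,1,2\}$ and only finitely many nonzero entries; $|S|=\sum_i S_i$. $\bm{z}=(z_1,z_2,\dots)$. **$F_S$.** Let $|S|=2N$ and choose $L$ with $S_c=0$ for $c>L$. Then $$F_S(x_1,\dots,x_N;\bm{z})=\sum\prod_{r=1}^{N}\prod_{c=1}^{L}W_{z_c/x_r}(v_{r-1,c},h_{r,c-1};v_{r,c},h_{r,c}),$$ summed over all $h_{r,c}\in\{0,1,2\}$ ($1\le r\le N$, $0\le c\le L$) and $v_{r,c}\in\{0,1,2\}$ ($0\le r\le N$, $1\le c\le L$) with $h_{r,0}=2$, $h_{r,L}=0$, $v_{0,c}=0$, $v_{N,c}=S_c$. (Independent of $L$.) For $N=1$ there is a single configuration; explicitly, $F_{2e_k}(x;\bm{z})=\prod_{j<k}W_{z_j/x}(0,2;0,2)\cdot W_{z_k/x}(0,2;2,0)$, and for $k<\ell$, $F_{e_k+e_\ell}(x;\bm{z})=\prod_{j<k}W_{z_j/x}(0,2;0,2)\cdot W_{z_k/x}(0,2;1,1)\cdot\prod_{k<j<\ell}W_{z_j/x}(0,1;0,1)\cdot W_{z_\ell/x}(0,1;1,0)$. **2-permutation matrices.** $\mathfrak{M}_2(N,S)$ is the set of all $N\times\infty$ matrices with non-negative integer entries, all row sums equal to $2$, and $i$-th column sum equal to $S_i$ for every $i\ge1$. *)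

(* Defs.v *)
(* MathComp; the classical layer is used for the sum over a set of matrices,
   and multinomials for algebraic independence.                              *)
From HB Require Import structures.
From mathcomp Require Import all_boot all_order all_algebra.
From mathcomp Require Import boolp classical_sets fsbigop.
From mathcomp.multinomials Require Import mpoly.

Set Implicit Arguments.
Unset Strict Implicit.
Unset Printing Implicit Defensive.

Import GRing.Theory.
Local Open Scope classical_set_scope.
Local Open Scope ring_scope.

(* Columns are numbered from 0: the entry [S c] (resp. [z c]) is the
   mathematical $S_{c+1}$ (resp. $z_{c+1}$).  Similarly for the rows.        *)

(* [supported L S] means that only the first L entries can be nonzero.       *)
Definition supported (L : nat) (S : nat -> nat) : Prop :=
  forall c, (L <= c)%N -> S c = 0%N.

Definition two_string (S : nat -> nat) : Prop :=
  (forall c, (S c <= 2)%N) /\ exists L, supported L S.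

(* The infinite sum of the entries of S is n; this includes finiteness of
   the support.                                                              *)
Definition sums_to (S : nat -> nat) (n : nat) : Prop :=
  exists2 L, supported L S & (\sum_(c < L) S c)%N = n.

Definition two_perm_mx (N : nat) (S : nat -> nat) :
    set ('I_N -> nat -> nat) :=
  [set sigma | (forall i, sums_to (sigma i) 2) /\
               (forall c, (\sum_(i < N) sigma i c)%N = S c)].
Arguments two_perm_mx : clear implicits.

Section Weights.
Variables (K : fieldType) (q : K).

(* i = bottom (incoming), j = left (incoming), k = top (outgoing),
   l = right (outgoing); x is the parameter of the horizontal line and y that
   of the vertical one, so that this is $W_{y/x}(i,j;k,l)$.                  *)
Definition IKweight (x y : K) (i j k l : nat) : K :=
  let d := x - q ^+ 2 * y in
  let D := (x - q ^+ 2 * y) * (x - q ^+ 3 * y) in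
  match (i, j, k, l) with
  | (0, 0, 0, 0)%N | (2, 2, 2, 2)%N => 1
  | (1, 0, 1, 0)%N | (2, 1, 2, 1)%N => q ^+ 2 * (x - y) / d
  | (1, 0, 0, 1)%N | (2, 1, 1, 2)%N => (1 - q ^+ 2) * x / d
  | (0, 1, 1, 0)%N | (1, 2, 2, 1)%N => (1 - q ^+ 2) * y / d
  | (0, 1, 0, 1)%N | (1, 2, 1, 2)%N => (x - y) / d
  | (2, 0, 2, 0)%N => q ^+ 4 * (x - y) * (x - q * y) / D
  | (2, 0, 1, 1)%N => - (q * (1 - q) ^+ 2 * (1 + q) * x * (x - y) / D)
  | (2, 0, 0, 2)%N =>
      (1 - q ^+ 2) * x * (x + q * x - q * y - q ^+ 3 * y) / D
  | (1, 1, 2, 0)%N => - (q ^+ 4 * (1 + q) * (x - y) * y / D)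
  | (1, 1, 1, 1)%N =>
      (- (q * x ^+ 2) + (1 + q) * (1 - q ^+ 2 + q ^+ 4) * x * y
       - q ^+ 4 * y ^+ 2) / D
  | (1, 1, 0, 2)%N => (1 + q) * x * (x - y) / D
  | (0, 2, 2, 0)%N =>
      (1 - q ^+ 2) * (x + q ^+ 2 * x - q ^+ 2 * y - q ^+ 3 * y) * y / D
  | (0, 2, 1, 1)%N => q * (1 - q) ^+ 2 * (1 + q) * (x - y) * y / D
  | (0, 2, 0, 2)%N => (x - y) * (x - q * y) / D
  | _ => 0
  end.

(* The edge states of the N x L lattice: [h r c] sits on the horizontal edge
   to the left of column c (to the right of column c - 1), [v r c] on the
   vertical edge below row r (above row r - 1).                              *)
Definition boundary (N L : nat) (S : nat -> nat)
    (h : 'M['I_3]_(N, L.+1)) (v : 'M['I_3]_(N.+1, L)) : bool :=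
  [&& [forall r, h r ord0 == 2 :> nat],
      [forall r, h r ord_max == 0 :> nat],
      [forall c, v ord0 c == 0 :> nat]
    & [forall c, v ord_max c == S c :> nat]].

(* [lift ord0 r] is r + 1, and [widen_ord _ r] is r.                         *)
Definition config_weight (N L : nat) (x : 'I_N -> K) (z : nat -> K)
    (h : 'M['I_3]_(N, L.+1)) (v : 'M['I_3]_(N.+1, L)) : K :=
  \prod_(r < N) \prod_(c < L)
    IKweight (x r) (z c)
      (v (widen_ord (leqnSn N) r) c) (h r (widen_ord (leqnSn L) c))
      (v (lift ord0 r) c) (h r (lift ord0 c)).

(* $F_S(x_1,\dots,x_N;z)$ computed on L columns, for any L such that
   [supported L S] (the value does not depend on such an L).                 *)
Definition IKF (L N : nat) (S : nat -> nat) (x : 'I_N -> K) (z : nat -> K) : K :=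
  \sum_(h : 'M['I_3]_(N, L.+1)) \sum_(v : 'M['I_3]_(N.+1, L) | boundary S h v)
    config_weight x z h v.

End Weights.

Definition unit_string (a : nat) : nat -> nat := fun c => (c == a : nat).

(* The pair (a, b), a <= b, with U = e_a + e_b; it exists and is unique as
   soon as the entries of U sum to 2.                                        *)
Definition positions (U : nat -> nat) : nat * nat :=
  xget (0, 0)%N [set p | (p.1 <= p.2)%N /\
                         U = (fun c => unit_string p.1 c + unit_string p.2 c)%N].

Section Delta.
Variables (K : fieldType) (q : K) (z : nat -> K).

(* The seven explicit cases, for U = e_a + e_b and V = e_c + e_d with a <= b
   and c <= d; None when none of them applies.                               *)
Definition Delta_explicit (U V : nat * nat) (x y : K) : option K :=
  let: (a, b) := U in
  let: (c, d) := V in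
  if (b < c)%N then
    Some ((y - q ^+ 2 * x) * (y - q ^+ 3 * x) / ((y - x) * (y - q * x)))
  else if [&& a < c & d < b]%N then
    Some ((y - q ^+ 2 * x) * (q ^+ 2 * y - x) / (y - x) ^+ 2)
  else if [&& a < c, c < b & b < d]%N then
    Some ((y - q ^+ 2 * x) ^+ 2 * (x - q * y)
          / ((y - x) ^+ 2 * (y - q * x)))
  else if [&& a == c, a < b & b < d]%N then
    Some ((q ^+ 2 * x - y)
          * (x * y + q ^+ 2 * x * y - q ^+ 3 * y * z a - q ^+ 3 * x * z a)
          / (q * (1 - q) * (y - x) * (y - q * x) * z a))
  else if [&& b == c, a < b & b < d]%N then
    Some ((y - q ^+ 2 * x)
          * (x * y + q ^+ 2 * x * y - q ^+ 2 * y * z b - q ^+ 3 * x * z b)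
          / (q * (1 - q) * (y - x) ^+ 2 * z b))
  else if [&& b == d, a < c & c < b]%N then
    Some ((q ^+ 2 * x - y)
          * (x * y + q ^+ 2 * x * y - q ^+ 2 * y * z b - q ^+ 2 * x * z b)
          / ((1 - q) * (y - x) * (y - q * x) * z b))
  else if [&& a == c, b == d & a < b]%N then
    Some ((x * y + q ^+ 2 * x * y - q ^+ 3 * y * z a - q ^+ 3 * x * z a)
          * (x * y + q ^+ 2 * x * y - q ^+ 2 * y * z b - q ^+ 2 * x * z b)
          / (q * (1 - q) ^+ 2 * (y - q * x) * (x - q * y) * z a * z b))
  else None.

(* The remaining cases come from Delta_{U,V}(x,y) = Delta_{V,U}(y,x).  The
   final value 0 is only reached when U, V share a position at which U + V
   has an entry > 2, which is impossible for rows of a matrix whose column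
   sums form a 2-string.                                                     *)
Definition Delta (U V : nat -> nat) (x y : K) : K :=
  match Delta_explicit (positions U) (positions V) x y with
  | Some w => w
  | None =>
      match Delta_explicit (positions V) (positions U) y x with
      | Some w => w
      | None => 0
      end
  end.

End Delta.

(* Algebraic independence over the prime ring (which forces K to have
   characteristic 0).                                                        *)
Definition alg_independent (K : fieldType) (s : seq K) : Prop :=
  forall p : {mpoly int[size s]}, p != 0 ->
    (map_mpoly (fun m : int => m%:~R : K) p).@[fun i => s`_i] != 0.

(* q, x_1, ..., x_N, z_1, z_2, ... behave as independent indeterminates: an
   identity between rational functions is an identity between their values
   at such a family.                                                         *)
Definition generic (K : fieldType) (N : nat) (q : K) (x : 'I_N -> K)
    (z : nat -> K) : Prop :=
  forall L, alg_independent (q :: codom x ++ mkseq z L).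

(* Main.v *)
(* One column of parameter z acts on the N-fold tensor power of the three-state
   horizontal space by operators T_0(z), T_1(z), T_2(z), according to its top
   state, and F_S is the matrix coefficient of T_{S_L} ... T_{S_1} from |2..2>
   to |0..0>.  The Yang-Baxter equation gives exchange relations for the T_s.

   There is a basis f_h, h in {0,1,2}^N, in which T_0 is diagonal and T_1, T_2
   lower the rows by one or two units in total, with coefficients that are
   products over rows and over pairs of rows; moreover f_{2..2} = |2..2>, and
   the coefficient of f_h at |0..0> vanishes unless h = 0.  Expanding the
   product of the T_s over the lowering paths from 2..2 to 0..0 therefore gives
   a sum over 2-permutation matrices; the row factors multiply to the F_{s(i)}
   and the pair factors to the Delta_{s(i),s(j)}.

   The basis is built row by row.  When a row of parameter y is added on top,
     f_{h,2} = f_h (x) |2>,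
     f_{h,1} is proportional to T_1(y/q) f_{h,2}, where T_0(y/q) f_{h,2} = 0,
     f_{h,0} = sum_l T_l(y) f_h (x) |l>, because a column of the same parameter
       as a row acts on it as a permutation.
   The exchange relations carry the action of the T_s over to f_{h,1} and
   f_{h,0}; what remains is a finite list of scalar identities. *)

From Stdlib Require Import ZArith Ring_polynom InitialRing Ring_theory.
From HB Require Import structures.
Require Import Defs.
From mathcomp Require Import all_boot all_order all_algebra.
From mathcomp Require Import ring zify boolp classical_sets fsbigop.
From mathcomp.multinomials Require Import mpoly.

Set Implicit Arguments.
Unset Strict Implicit.
Unset Printing Implicit Defensive.

Import GRing.Theory.
Local Open Scope classical_set_scope.
Local Open Scope ring_scope.

(** The pair factors couple all rows, so the induction over rows closes only if every comparison of
    coefficients involves a bounded number of old rows. Comparing components along the new row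
    achieves this for T_0 and T_1 on f_{h,1} and for all three operators on f_{h,2}: at most two old
    rows are lowered. It fails for T_2(z) f_{h,1}, whose component l = 2 lowers three old rows.
    There the exchange relation between T_2(z) and T_1(w), w = y/q, is applied to f_{h,2}. It
    expresses T_2(z) f_{h,1} through actions already known, and since T_0(w) kills every f_{h',2},
    no term along an f_{h',2} survives; two old rows suffice again.

    The price is that w is not generic with respect to y. A column is therefore required to be
    generic with respect to the old rows only, and for the new row it is only asked that the weights
    have no pole ([regular]), except where a division needs more. *)

Lemma sum3 (V : nmodType) (F : nat -> V) : \sum_(k < 3) F k = F 0%N + F 1%N + F 2%N.
Proof. by rewrite !big_ord_recl big_ord0 /= addr0 addrA. Qed.

(** * The Yang-Baxter equation *)

(* The equation is 729 polynomial identities; they are checked by computation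
   on formal polynomials, through the normalisation function of the ring tactic. *)
Section FormalPolynomials.
Local Notation PE := (PExpr Z).

Definition peqb (a b : PE) : bool :=
  let norm := norm_subst Z0 (Zpos xH) Z.add Z.mul Z.sub Z.opp Zeq_bool Z.quotrem O nil in
  Ring_polynom.Peq Zeq_bool (norm a) (norm b).

Variable K : fieldType.

Definition peval (l : seq K) : PE -> K :=
  PEeval 0 1 +%R *%R (fun a b : K => a - b) -%R (gen_phiZ 0 1 +%R *%R -%R)
    N.to_nat (@GRing.exp K) l.

Lemma field_ring_theory : ring_theory 0 1 +%R *%R (fun a b : K => a - b) -%R eq.
Proof.
split=> //; [exact: add0r|exact: addrC|exact: addrA|exact: mul1r|exact: mulrC
  |exact: mulrA|exact: mulrDl|exact: subrr].
Qed.

Lemma field_ring_ext : ring_eq_ext +%R *%R -%R (@eq K).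
Proof. by split=> [a b -> c d ->|a b -> c d ->|a b ->]. Qed.

Lemma peqbP l a b : peqb a b -> peval l a = peval l b.
Proof.
move=> H; have Rs := RelationClasses.eq_equivalence.
have pw : power_theory (1 : K) *%R (@eq K) N.to_nat (@GRing.exp K).
  split=> r [|n] //=.
  elim/Pos.peano_ind: n => [|n IH]; first by rewrite expr1.
  rewrite Pnat.Pos2Nat.inj_succ exprS IH; symmetry.
  by apply: (pow_pos_succ (Rs _) _ (@mulrA K)) => a b -> c d ->.
have th := field_ring_theory; have ext := field_ring_ext.
exact: (ring_correct (Rs _) ext (Rth_ARth (Rs _) ext th) (gen_phiZ_morph (Rs _) ext th)
   pw (Ztriv_div_th (Rs _) _) O l nil a b I H).
Qed.
End FormalPolynomials.

Section FormalWeights.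
Local Notation PE := (PExpr Z).
Local Notation "a + b" := (PEadd a b) : pe_scope.
Local Notation "a - b" := (PEsub a b) : pe_scope.
Local Notation "a * b" := (PEmul a b) : pe_scope.
Local Notation "- a" := (PEopp a) : pe_scope.
Local Notation "a ^+ n" := (PEpow a n%num) : pe_scope.
Local Notation "1" := PEI : pe_scope.
Local Notation "0" := PEO : pe_scope.
Local Open Scope pe_scope.

(* The weights multiplied by their common denominator [d * e]. *)
Definition pIK (q x y : PE) (i j k l : nat) : PE :=
  let d := x - q ^+ 2 * y in
  let e := x - q ^+ 3 * y in
  match (i, j, k, l) with
  | (0, 0, 0, 0)%N | (2, 2, 2, 2)%N => d * e
  | (1, 0, 1, 0)%N | (2, 1, 2, 1)%N => q ^+ 2 * (x - y) * e
  | (1, 0, 0, 1)%N | (2, 1, 1, 2)%N => (1 - q ^+ 2) * x * e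
  | (0, 1, 1, 0)%N | (1, 2, 2, 1)%N => (1 - q ^+ 2) * y * e
  | (0, 1, 0, 1)%N | (1, 2, 1, 2)%N => (x - y) * e
  | (2, 0, 2, 0)%N => q ^+ 4 * (x - y) * (x - q * y)
  | (2, 0, 1, 1)%N => - (q * (1 - q) ^+ 2 * (1 + q) * x * (x - y))
  | (2, 0, 0, 2)%N =>
      (1 - q ^+ 2) * x * (x + q * x - q * y - q ^+ 3 * y)
  | (1, 1, 2, 0)%N => - (q ^+ 4 * (1 + q) * (x - y) * y)
  | (1, 1, 1, 1)%N =>
      (- (q * x ^+ 2) + (1 + q) * (1 - q ^+ 2 + q ^+ 4) * x * y
       - q ^+ 4 * y ^+ 2)
  | (1, 1, 0, 2)%N => (1 + q) * x * (x - y)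
  | (0, 2, 2, 0)%N =>
      (1 - q ^+ 2) * (x + q ^+ 2 * x - q ^+ 2 * y - q ^+ 3 * y) * y
  | (0, 2, 1, 1)%N => q * (1 - q) ^+ 2 * (1 + q) * (x - y) * y
  | (0, 2, 0, 2)%N => (x - y) * (x - q * y)
  | _ => 0
  end.

Definition psum3 (F : nat -> PE) : PE := F 0%N + F 1%N + F 2%N.
Definition all3 (P : nat -> bool) := P 0%N && P 1%N && P 2%N.

Let q := PEX Z 1. Let x := PEX Z 2. Let y := PEX Z 3. Let z := PEX Z 4.

Definition YBlhs a b d s t e : PE :=
  psum3 (fun k => psum3 (fun l => psum3 (fun m =>
   pIK q x y a d k m * pIK q x z b m l e * pIK q y z l k s t))).
Definition YBrhs a b d s t e : PE :=
  psum3 (fun k => psum3 (fun l => psum3 (fun m =>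
   pIK q y z b a l k * pIK q x z l d s m * pIK q x y k m t e))).

Lemma YBcheck :
  all3 (fun a => all3 (fun b => all3 (fun d => all3 (fun s => all3 (fun t => all3 (fun e =>
    peqb (YBlhs a b d s t e) (YBrhs a b d s t e))))))).
Proof. by vm_compute. Qed.
End FormalWeights.

Lemma all3P P k : all3 P -> (k < 3)%N -> P k.
Proof. by case/andP => /andP[]; case: k => [|[|[|k]]]. Qed.

Section Numerators.
Variables (K : fieldType) (q : K).

Definition IKden (x y : K) := (x - q ^+ 2 * y) * (x - q ^+ 3 * y).
Definition IKnum (x y : K) (i j k l : nat) : K :=
  peval [:: q; x; y] (pIK (PEX Z 1) (PEX Z 2) (PEX Z 3) i j k l).

Lemma IKweightE x y i j k l : IKden x y != 0 ->
  IKweight q x y i j k l = IKnum x y i j k l / IKden x y.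
Proof.
rewrite /IKden mulf_eq0 negb_or => /andP[d0 e0].
case: i => [|[|[|i]]]; case: j => [|[|[|j]]] //; rewrite /IKweight /IKnum /=;
  case: k => [|[|[|k]]] //; case: l => [|[|[|l]]] //=;
  by rewrite ?mul0r //; field; rewrite ?d0 ?e0.
Qed.

(** Lets a formal weight taken at any two of the four variables of the Yang-Baxter check be read as
    a numerator. *)
Lemma pIKE l Q X Y i j k m : peval l Q = q ->
  peval l (pIK Q X Y i j k m) = IKnum (peval l X) (peval l Y) i j k m.
Proof.
rewrite /IKnum => <-.
by case: i => [|[|[|i]]]; case: j => [|[|[|j]]] //; case: k => [|[|[|k]]] //;
  case: m => [|[|[|m]]] //.
Qed.

Lemma YBnum (x y z : K) (a b d s t e : nat) :
  (a < 3)%N -> (b < 3)%N -> (d < 3)%N -> (s < 3)%N -> (t < 3)%N -> (e < 3)%N ->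
  \sum_(k < 3) \sum_(l < 3) \sum_(m < 3)
    IKnum x y a d k m * IKnum x z b m l e * IKnum y z l k s t =
  \sum_(k < 3) \sum_(l < 3) \sum_(m < 3)
    IKnum y z b a l k * IKnum x z l d s m * IKnum x y k m t e.
Proof.
move=> a3 b3 d3 s3 t3 e3.
have := all3P (all3P (all3P (all3P (all3P (all3P YBcheck a3) b3) d3) s3) t3) e3.
move=> /peqbP - /(_ K [:: q; x; y; z]).
rewrite /YBlhs /YBrhs => E.
set l := [:: q; x; y; z] in E *.
have L F : peval l (psum3 F) = \sum_(k < 3) peval l (F k).
  by rewrite (sum3 (fun k => peval l (F k))).
have PM A B : peval l (PEmul A B) = peval l A * peval l B by [].
transitivity (peval l (YBlhs a b d s t e)); last rewrite E.
  rewrite /YBlhs L; apply: eq_bigr => k _; rewrite L; apply: eq_bigr => k' _.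
  by rewrite L; apply: eq_bigr => m _; rewrite !PM !pIKE.
rewrite /YBrhs L; apply: eq_bigr => k _; rewrite L; apply: eq_bigr => k' _.
by rewrite L; apply: eq_bigr => m _; rewrite !PM !pIKE.
Qed.
End Numerators.

(** * Sums over small functions *)

(** Lowering two rows gives the same vector in either order, so coefficients can only be compared
    after the terms (i, j) and (j, i) have been joined. *)
Lemma sum_sym_split (V : nmodType) n (F : nat -> nat -> V) :
  \sum_(i < n) \sum_(j < n) F i j =
  \sum_(i < n) F i i + \sum_(i < n) \sum_(j < n | (j < i)%N) (F i j + F j i).
Proof.
under [X in _ = _ + X]eq_bigr => i _ do rewrite big_split /=.
rewrite big_split /= [X in _ + (_ + X)](exchange_big_dep xpredT) //=.
rewrite -!big_split; apply: eq_bigr => i _ /=.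
rewrite (bigD1 i) //=; congr (_ + _).
rewrite (bigID (fun j : 'I_n => (j < i)%N)) /=; congr (_ + _); apply: eq_bigl => j.
  by apply: andb_idl => ji; rewrite neq_ltn ji.
by rewrite -leqNgt ltn_neqAle eq_sym.
Qed.

Lemma sumrD (V : nmodType) I (r : seq I) P (F1 F2 : I -> V) :
  \sum_(i <- r | P i) F1 i + \sum_(i <- r | P i) F2 i = \sum_(i <- r | P i) (F1 i + F2 i).
Proof. by rewrite big_split. Qed.

Lemma addr6 (V : nmodType) (a b c d e f : V) :
  a + b + (c + d) + (e + f) = (a + c + e) + (b + d + f).
Proof. by rewrite (addrACA a b) addrACA. Qed.

Lemma addr10 (V : nmodType) (a b c d e f a' b' c' d' : V) :
  a + (b + (c + d)) + (e + f) + (a' + (b' + (c' + d'))) =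
  (a + b + (a' + b')) + ((c + e + c') + (d + f + d')).
Proof. by rewrite !addrA (ACl (1*2*7*8*3*5*9*4*6*10))%AC. Qed.

Lemma sum_tri_recr (V : nmodType) n (F : nat -> nat -> V) :
  \sum_(i < n.+1) \sum_(j < n.+1 | (j < i)%N) F i j =
  \sum_(i < n) \sum_(j < n | (j < i)%N) F i j + \sum_(j < n) F n j.
Proof.
rewrite big_ord_recr /=; congr (_ + _).
  apply: eq_bigr => i _; rewrite big_mkcond big_ord_recr /= -big_mkcond.
  by rewrite ltnNge ltnW // addr0.
rewrite big_mkcond big_ord_recr /= ltnn addr0.
by apply: eq_bigr => j _; rewrite ltn_ord.
Qed.

Section Sums.
Variable V : nmodType.

Definition upd (g : nat -> nat) (n j : nat) : nat -> nat := fun k => if k == n then j else g k.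

(* The sum over all functions g from {0, .., n-1} to {0, 1, 2}, extended by 0.
   Plain functions on nat spare the casts between ordinals. *)
Fixpoint fsum n (F : (nat -> nat) -> V) : V :=
  if n is m.+1 then \sum_(j < 3) fsum m (fun g => F (upd g m j)) else F (fun=> 0%N).

Definition ccons (g : nat -> nat) (M : nat -> nat -> nat) : nat -> nat -> nat :=
  fun c => if c is c'.+1 then M c' else g.

(* The column index comes first: [M c] is column [c], of height N. *)
Fixpoint mxsum N L (F : (nat -> nat -> nat) -> V) : V :=
  if L is l.+1 then fsum N (fun g => mxsum N l (fun M => F (ccons g M)))
  else F (fun _ _ => 0%N).

Definition small n (g : nat -> nat) :=
  (forall k, (g k < 3)%N) /\ forall k, (n <= k)%N -> g k = 0%N.

Lemma upd_small n g j : small n g -> (j < 3)%N -> small n.+1 (upd g n j).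
Proof.
move=> [g3 g0] j3; split=> k; rewrite /upd; first by case: ifP.
by move=> nk; rewrite gtn_eqF // g0 // ltnW.
Qed.

Lemma eq_fsum n F1 F2 : (forall g, small n g -> F1 g = F2 g) -> fsum n F1 = fsum n F2.
Proof.
elim: n F1 F2 => [|n IH] F1 F2 E /=; first by apply: E.
by apply: eq_bigr => j _; apply: IH => g gs; apply: E; apply: upd_small.
Qed.

Lemma fsumD n F1 F2 : fsum n (fun g => F1 g + F2 g) = fsum n F1 + fsum n F2.
Proof.
elim: n F1 F2 => [|n IH] F1 F2 //=; rewrite -big_split; apply: eq_bigr => j _.
by rewrite IH.
Qed.

Lemma fsum0 n : fsum n (fun=> 0) = 0.
Proof. by elim: n => //= n IH; rewrite big1. Qed.
Lemma fsum_sum n I (r : seq I) P (F : I -> (nat -> nat) -> V) :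
  fsum n (fun g => \sum_(i <- r | P i) F i g) = \sum_(i <- r | P i) fsum n (F i).
Proof.
elim: r => [|i r IH].
  by rewrite big_nil -[RHS](fsum0 n); apply: eq_fsum => g _; rewrite big_nil.
rewrite big_cons -IH; case: ifP => Pi.
  by rewrite -fsumD; apply: eq_fsum => g _; rewrite big_cons Pi.
by apply: eq_fsum => g _; rewrite big_cons Pi.
Qed.

Lemma fsum_exch n m (F : (nat -> nat) -> (nat -> nat) -> V) :
  fsum n (fun g => fsum m (F g)) = fsum m (fun g' => fsum n (F^~ g')).
Proof.
elim: n F => //= n IH F.
by rewrite fsum_sum; apply: eq_bigr => j _; rewrite IH.
Qed.

Definition msmall N L (M : nat -> nat -> nat) :=
  (forall c, small N (M c)) /\ forall c k, (L <= c)%N -> M c k = 0%N.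

Lemma ccons_msmall N L g M : small N g -> msmall N L M -> msmall N L.+1 (ccons g M).
Proof. by move=> gs [Ms M0]; split=> [[|c]|[|c] k] //=; apply: M0. Qed.

Lemma eq_mxsum N L F1 F2 :
  (forall M, msmall N L M -> F1 M = F2 M) -> mxsum N L F1 = mxsum N L F2.
Proof.
elim: L F1 F2 => [|L IH] F1 F2 E /=; first by apply: E.
apply: eq_fsum => g gs; apply: IH => M Ms; apply: E.
exact: ccons_msmall.
Qed.

Lemma mxsum_fsum_exch N L m (F : (nat -> nat -> nat) -> (nat -> nat) -> V) :
  mxsum N L (fun M => fsum m (F M)) = fsum m (fun g => mxsum N L (F^~ g)).
Proof.
elim: L F => //= L IH F; rewrite fsum_exch; apply: eq_fsum => g _.
by rewrite IH.
Qed.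

(** The passage from matrices to functions on nat transposes (column index first) and extends by 0,
    which matches [mxsum] and [fsum]. *)
Definition mfun N L (h : 'M['I_3]_(N, L)) : nat -> nat -> nat := fun c r =>
  if insub r is Some i then if insub c is Some j then h i j : nat else 0%N else 0%N.

Lemma mfunE N L (h : 'M['I_3]_(N, L)) (i : 'I_N) (j : 'I_L) : mfun h j i = h i j.
Proof. by rewrite /mfun !valK. Qed.

(** The last entry is split off, since [fsum] recurses on the last index; [sum_mx] below splits off
    the first column, as [mxsum] does. *)
Lemma sum_cV N (F : (nat -> nat) -> V) : \sum_(a : 'cV['I_3]_N) F (mfun a 0) = fsum N F.
Proof.
elim: N F => [|N IH] F.
  rewrite (eq_bigr (fun=> F (fun=> 0%N))); last first.
    move=> a _; congr F; apply: funext => k; rewrite /mfun.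
    by case: insubP.
  by rewrite big_const card_mx mul0n expn0 /= addr0.
pose snoc (p : 'I_3 * 'cV['I_3]_N) : 'cV['I_3]_N.+1 :=
  \col_i oapp (fun i' => p.2 i' 0) p.1 (unlift ord_max i).
pose unsnoc (a : 'cV['I_3]_N.+1) : 'I_3 * 'cV['I_3]_N :=
  (a ord_max 0, \col_i a (lift ord_max i) 0).
have K1 : cancel snoc unsnoc.
  move=> [j a]; rewrite /unsnoc /snoc !mxE unlift_none /=; congr (_, _).
  by apply/colP => i; rewrite !mxE liftK.
have K2 : cancel unsnoc snoc.
  move=> a; apply/colP => i; rewrite mxE; case: unliftP => [i' ->|->] //=.
  by rewrite mxE.
rewrite (reindex snoc) /=; last by apply: onW_bij; exists unsnoc.
rewrite -(pair_bigA _ (fun j a => F (mfun (snoc (j, a)) 0))) /=.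
apply: eq_bigr => j _; rewrite -IH; apply: eq_bigr => a _; congr F.
apply: funext => k; rewrite /upd; case: (ltngtP k N) => kN.
- have -> : k = lift ord_max (Ordinal kN) by rewrite /= /bump leqNgt kN.
  rewrite (mfunE _ _ ord0) mxE liftK /=.
  by rewrite -(mfunE a (Ordinal kN) ord0) /= /bump leqNgt kN.
- by rewrite /mfun !insubF //; lia.
- by rewrite kN -[N]/(nat_of_ord (@ord_max N)) (mfunE _ _ ord0) mxE unlift_none.
Qed.

Lemma sum_mx N L (F : (nat -> nat -> nat) -> V) :
  \sum_(h : 'M['I_3]_(N, L)) F (mfun h) = mxsum N L F.
Proof.
elim: L F => [|L IH] F /=.
  rewrite (eq_bigr (fun=> F (fun _ _ => 0%N))); last first.
    move=> a _; congr F; apply: funext => k; apply: funext => l; rewrite /mfun.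
    by case: insubP => // i _ _; case: insubP.
  by rewrite big_const card_mx muln0 expn0 /= addr0.
rewrite -sum_cV.
pose glue (p : 'cV['I_3]_N * 'M['I_3]_(N, L)) : 'M['I_3]_(N, L.+1) :=
  (row_mx p.1 p.2 : 'M_(N, 1 + L)).
rewrite (reindex glue) /=; last first.
  apply: onW_bij; exists (fun a : 'M_(N, 1 + L) => (lsubmx a, rsubmx a)).
    by move=> [a b]; rewrite row_mxKl row_mxKr.
  by move=> a; rewrite /glue hsubmxK.
rewrite -(pair_bigA _ (fun a h => F (mfun (glue (a, h))))) /=.
apply: eq_bigr => a _; rewrite -IH; apply: eq_bigr => h _; congr F.
apply: funext => -[|c]; apply: funext => r; rewrite /mfun /=.
  case: insubP => // i _ ri; case: insubP => // j _ j0; case: insubP => // j' _ j'0.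
  rewrite -(row_mxEl a h); congr (nat_of_ord (row_mx a h i _)).
  by apply: val_inj; rewrite /= j0 j'0.
case: insubP => // i _ ri; case: insubP => [j jL jc|]; case: insubP => [j' j'L j'c|] //;
  try lia.
rewrite -(row_mxEr a h); congr (nat_of_ord (row_mx a h i _)).
by apply: val_inj; rewrite /= jc j'c.
Qed.

End Sums.

Lemma fsumZ (R : pzRingType) (V : lmodType R) n (c : R) (F : (nat -> nat) -> V) :
  fsum n (fun g => c *: F g) = c *: fsum n F.
Proof.
elim: n F => //= n IH F; rewrite scaler_sumr; apply: eq_bigr => j _.
by rewrite IH.
Qed.

Lemma fsumZl (R : pzRingType) (V : lmodType R) n (F : (nat -> nat) -> R) (v : V) :
  fsum n (fun g => F g *: v) = fsum n F *: v.
Proof.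
elim: n F => //= n IH F; rewrite scaler_suml; apply: eq_bigr => j _.
by rewrite IH.
Qed.

Lemma fsumMr (R : pzRingType) n (c : R) (F : (nat -> nat) -> R) :
  fsum n (fun g => F g * c) = fsum n F * c.
Proof. exact: (@fsumZl R R^o). Qed.
Lemma fsumMl (R : pzRingType) n (c : R) (F : (nat -> nat) -> R) :
  fsum n (fun g => c * F g) = c * fsum n F.
Proof. exact: (@fsumZ R R^o). Qed.
Lemma mxsumMl (R : pzRingType) N L (c : R) (F : (nat -> nat -> nat) -> R) :
  mxsum N L (fun g => c * F g) = c * mxsum N L F.
Proof.
elim: L F => //= L IH F; rewrite -fsumMl; apply: eq_fsum => g _.
by rewrite IH.
Qed.

Definition agree n (g h : nat -> nat) : bool := [forall k : 'I_n, g k == h k].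

Lemma agreeP n g h : reflect (forall k, (k < n)%N -> g k = h k) (agree n g h).
Proof.
apply: (iffP forallP) => [E k kn|E k]; last by rewrite E.
exact: (eqP (E (Ordinal kn))).
Qed.

Lemma agreeS n g h : agree n.+1 g h = (g n == h n) && agree n g h.
Proof.
apply/agreeP/andP => [E|[/eqP En /agreeP E] k].
  by split; [rewrite E|apply/agreeP => k kn; apply/E/leqW].
by rewrite ltnS leq_eqVlt => /orP[/eqP->|/E].
Qed.

Lemma fsum_pick (R : pzRingType) n h (F : (nat -> nat) -> R) : small n h ->
  fsum n (fun g => (agree n g h)%:R * F g) = F h.
Proof.
elim: n h F => [|n IH] h F [h3 h0] /=.
  have -> : h = fun=> 0%N by apply: funext => k; apply: h0.
  by rewrite (_ : agree 0 _ _) ?mul1r //; apply/agreeP.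
rewrite (bigD1 (Ordinal (h3 n))) //= [X in _ + X]big1 ?addr0; last first.
  move=> j; rewrite -val_eqE /= => /negPf jh; rewrite -[RHS](fsum0 R n).
  by apply: eq_fsum => g _; rewrite agreeS /upd eqxx jh mul0r.
(* The induction hypothesis needs a function supported below n, so entry n of h is cleared here and
   restored afterwards. *)
have hs : small n (upd h n 0).
  split=> k; rewrite /upd; first by case: ifP.
  by rewrite leq_eqVlt eq_sym => /orP[->//|kn]; rewrite gtn_eqF // h0.
transitivity (F (upd (upd h n 0) n (h n))); last first.
  by congr F; apply: funext => k; rewrite /upd; case: eqP => // ->.
rewrite -(IH _ (fun g => F (upd g n (h n))) hs).
apply: eq_fsum => g gs; rewrite agreeS /upd !eqxx /=; congr (_%:R * _).
by congr nat_of_bool; apply: eq_forallb => k; rewrite !(ltn_eqF (ltn_ord k)).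
Qed.

(** * Sums over lowerings of total degree at most two *)

Definition plusf (d e : nat -> nat) : nat -> nat := fun k => (d k + e k)%N.
Definition minusf (h d : nat -> nat) : nat -> nat := fun k => (h k - d k)%N.

Section Deg.
Variable V : nmodType.
Implicit Type F : (nat -> nat) -> V.

Definition dsum (s n : nat) F := fsum n (fun d => if (\sum_(k < n) d k == s)%N then F d else 0).

Lemma dsumS s n F : dsum s n.+1 F =
  \sum_(j < 3) if (j <= s)%N then dsum (s - j)%N n (fun d => F (upd d n j)) else 0.
Proof.
apply: eq_bigr => j _; rewrite /dsum.
transitivity (fsum n (fun d => if (\sum_(k < n) d k + j == s)%N then F (upd d n j) else 0)).
  apply: eq_fsum => d _; rewrite big_ord_recr /= {2}/upd eqxx.
  by under eq_bigr => k _ do rewrite /upd (ltn_eqF (ltn_ord k)).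
case: leqP => js; last first.
  rewrite -[RHS](fsum0 V n); apply: eq_fsum => d _; case: eqP => // E.
  by move: js; rewrite -E ltnNge leq_addl.
apply: eq_fsum => d _; congr (if _ then _ else _).
by rewrite -(eqn_add2r j (\sum_(k < n) d k)) subnK.
Qed.

Lemma dsumE s n F : dsum s n.+1 F = dsum s n (fun d => F (upd d n 0))
  + (if (1 <= s)%N then dsum (s - 1)%N n (fun d => F (upd d n 1)) else 0)
  + (if (2 <= s)%N then dsum (s - 2)%N n (fun d => F (upd d n 2)) else 0).
Proof. by rewrite dsumS !big_ord_recl big_ord0 /= addr0 subn0 addrA. Qed.

Lemma dsum0 n F : dsum 0 n F = F (fun=> 0%N).
Proof.
elim: n F => [|n IH] F; first by rewrite /dsum /= big_ord0.
rewrite dsumE /= ?subnn ?addr0 IH; congr F.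
by apply: funext => k; rewrite /upd; case: ifP.
Qed.

Lemma upd_unit i n : (i < n)%N -> upd (unit_string i) n 0 = unit_string i.
Proof.
by move=> ni; apply: funext => k; rewrite /upd /unit_string; case: (k =P n) => // ->; lia.
Qed.

Lemma dsum1 n F : dsum 1 n F = \sum_(i < n) F (unit_string i).
Proof.
elim: n F => [|n IH] F; first by rewrite /dsum /= !big_ord0.
rewrite dsumE /= ?subnn ?addr0 IH dsum0 big_ord_recr /=; congr (_ + _).
by apply: eq_bigr => i _; rewrite upd_unit.
Qed.

Lemma dsum2 n F : dsum 2 n F =
  \sum_(i < n) F (plusf (unit_string i) (unit_string i)) +
  \sum_(i < n) \sum_(j < n | (j < i)%N) F (plusf (unit_string i) (unit_string j)).
Proof.
elim: n F => [|n IH] F; first by rewrite /dsum /= !big_ord0 addr0.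
rewrite dsumE /= IH dsum1 dsum0.
rewrite (sum_tri_recr n (fun i j => F (plusf (unit_string i) (unit_string j)))) big_ord_recr /=.
rewrite -[LHS]addrA [X in _ + X]addrC addrACA; congr ((_ + _) + (_ + _)).
- apply: eq_bigr => i _; congr F; apply: funext => k; rewrite /upd /plusf /unit_string.
  by case: (k =P n) => // ->; rewrite gtn_eqF.
- by congr F; apply: funext => k; rewrite /upd /plusf /unit_string; case: (k =P n).
- apply: eq_bigr => i _; apply: eq_bigr => j _; congr F; apply: funext => k.
  by rewrite /upd /plusf /unit_string; case: (k =P n) => // ->; rewrite !gtn_eqF.
- apply: eq_bigr => i _; congr F; apply: funext => k; rewrite /upd /plusf /unit_string.
  by case: (k =P n) => // ->; rewrite gtn_eqF.
Qed.
End Deg.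

(** * Products over pairs of rows *)

Section PairProd.
Variables (R : comPzRingType) (n : nat) (b : nat -> nat -> R).
Hypothesis bC : forall i j : nat, i != j -> b i j = b j i.

(** By symmetry a factor [b k i] with k < i can be read as [b i k], so all pairs through i come out
    as one unordered product. *)
Lemma pairprodD1 (P : pred nat) i : (i < n)%N -> P i ->
  \prod_(k < n | P k) \prod_(l < n | P l && (k < l)%N) b k l =
  \prod_(l < n | P l && (l != i :> nat)) b i l *
  \prod_(k < n | P k && (k != i :> nat))
    \prod_(l < n | (P l && (l != i :> nat)) && (k < l)%N) b k l.
Proof.
move=> ni Pi; rewrite (bigD1 (Ordinal ni)) //=.
rewrite [X in _ = X * _](bigID (fun l : 'I_n => (i < l)%N)) /= -mulrA.
congr (_ * _).
  by apply: eq_bigl => l; rewrite -andbA; congr (_ && _); lia.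
rewrite (eq_bigr (fun k : 'I_n => (if (k < i)%N then b i k else 1) *
   \prod_(l < n | (P l && (l != i :> nat)) && (k < l)%N) b k l)); last first.
  move=> k /andP[Pk ki]; case: ltnP => ik.
    rewrite (bigD1 (Ordinal ni)) /=; last by rewrite Pi ik.
    rewrite bC //; congr (_ * _); apply: eq_bigl => l; rewrite -val_eqE /=.
    by rewrite andbAC.
  rewrite mul1r; apply: eq_bigl => l; rewrite andbAC; case: (P l) => //=.
  by rewrite -val_eqE /= in ki *; lia.
rewrite big_split /= -big_mkcondr /=; congr (_ * _).
by apply: eq_bigl => l; rewrite -val_eqE /=; case: (P l) => //=; lia.
Qed.
End PairProd.

Lemma fsum_linear (R : pzRingType) (U V : lmodType R) (f : {linear U -> V}) n
    (F : (nat -> nat) -> U) : f (fsum n F) = fsum n (fun g => f (F g)).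
Proof. by elim: n F => //= n IH F; rewrite linear_sum; apply: eq_bigr => j _; rewrite IH. Qed.

Lemma prod_supp (R : comPzRingType) L (s : seq nat) (F : nat -> R) :
  uniq s -> all (fun k => (k < L)%N) s -> (forall k, k \notin s -> F k = 1) ->
  \prod_(k < L) F k = \prod_(k <- s) F k.
Proof.
move=> us /allP sL F1; rewrite -(big_mkord xpredT) (bigID (mem s)) /= [X in _ * X]big1 //.
rewrite mulr1 -big_filter; apply: perm_big; apply: uniq_perm => //.
  by rewrite filter_uniq // iota_uniq.
move=> k; rewrite mem_filter mem_index_iota /=.
by apply: andb_idr => /sL.
Qed.

(** * Strings of total two and their positions *)

Lemma sum_supported L L' (U : nat -> nat) : supported L U -> (L <= L')%N ->
  (\sum_(c < L') U c = \sum_(c < L) U c)%N.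
Proof.
move=> sU LL'; rewrite -!(big_mkord xpredT) (big_cat_nat (n := L)) //=.
rewrite [X in (_ + X)%N]big_nat_cond [X in (_ + X)%N]big1 ?addn0 // => c /andP[/andP[Lc _] _].
exact: sU.
Qed.

Lemma sums_toE L (U : nat -> nat) m : supported L U -> sums_to U m -> (\sum_(c < L) U c = m)%N.
Proof.
move=> sU [L' sU' <-]; case: (leqP L L') => LL'.
  by rewrite (sum_supported sU LL').
by rewrite (sum_supported sU' (ltnW LL')).
Qed.

Lemma sum_unit k a : (\sum_(c < k) unit_string a c = (a < k))%N.
Proof.
elim: k => [|k IH]; first by rewrite big_ord0.
by rewrite big_ord_recr /= IH /unit_string; lia.
Qed.

Lemma unit_exists L (U : nat -> nat) m : (\sum_(c < L) U c = m.+1)%N ->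
  exists2 a, (a < L)%N & (0 < U a)%N.
Proof.
move=> E; have : [exists c : 'I_L, (0 < U c)%N].
  apply: contraT; rewrite negb_exists => /forallP H.
  by rewrite big1 // in E => c _; apply/eqP; rewrite -leqn0 leqNgt H.
by case/existsP => c Uc; exists c.
Qed.

Lemma string_positions L (U : nat -> nat) : supported L U -> (\sum_(c < L) U c = 2)%N ->
  exists a b, (a <= b < L)%N /\ U = (fun c => unit_string a c + unit_string b c)%N.
Proof.
move=> sU E; have [a aL Ua] := unit_exists E.
pose U1 c := (U c - unit_string a c)%N.
have U1E c : (U c = unit_string a c + U1 c)%N.
  by rewrite /U1 /unit_string; case: eqP => [->|_] /=; lia.
have E1 : (\sum_(c < L) U1 c = 1)%N.
  move: E; under eq_bigr => c _ do rewrite U1E.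
  by rewrite big_split /= sum_unit aL; lia.
have [b bL Ub] := unit_exists E1.
pose U2 c := (U1 c - unit_string b c)%N.
have U2E c : (U1 c = unit_string b c + U2 c)%N.
  by rewrite /U2 /unit_string; case: eqP => [->|_] /=; lia.
have E2 : (\sum_(c < L) U2 c = 0)%N.
  move: E1; under eq_bigr => c _ do rewrite U2E.
  by rewrite big_split /= sum_unit bL; lia.
have U20 c : U2 c = 0%N.
  case: (ltnP c L) => cL; last by rewrite /U2 /U1 sU.
  move/eqP: E2; rewrite sum_nat_eq0 => /forallP/(_ (Ordinal cL)).
  by move/eqP.
have UE c : U c = (unit_string a c + unit_string b c)%N by rewrite U1E U2E U20 addn0.
case: (leqP a b) => ab; [exists a, b | exists b, a]; split; try lia.
  by apply: funext.
by apply: funext => c; rewrite UE addnC.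
Qed.

Lemma positionsE a b : (a <= b)%N ->
  positions (fun c => unit_string a c + unit_string b c)%N = (a, b).
Proof.
move=> ab; rewrite /positions; case: xgetP => [[a' b'] _ [/= ab' E]|/(_ (a, b))]; last first.
  by case; split.
have H c : ((c == a) + (c == b) = (c == a') + (c == b'))%N by have := congr1 (fun f => f c) E.
have := H a; have := H b; have := H a'; have := H b'; rewrite !eqxx => *.
by congr (_, _); lia.
Qed.

(** The guards of [Delta_explicit] alone, which makes the coverage of the cases a question of linear
    arithmetic. *)
Definition explicit_case (a b c d : nat) : bool :=
  [|| b < c, (a < c) && (d < b), [&& a < c, c < b & b < d], [&& a == c, a < b & b < d],
      [&& b == c, a < b & b < d], [&& b == d, a < c & c < b] | [&& a == c, b == d & a < b]]%N.

Lemma explicit_None (K : fieldType) (q : K) z a b c d u v :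
  Delta_explicit q z (a, b) (c, d) u v = None -> ~~ explicit_case a b c d.
Proof.
rewrite /Delta_explicit /explicit_case.
by do 7 (case: ifP => //= _).
Qed.

(** Up to exchanging the two rows, the seven cases miss only configurations such as 2e_a against e_a
    + e_b, where U + V exceeds 2 somewhere. The four bounds are U + V at a, b, c, d. *)
Lemma explicit_total a b c d : (a <= b)%N -> (c <= d)%N ->
  ((a == a) + (a == b) + ((a == c) + (a == d)) <= 2)%N ->
  ((b == a) + (b == b) + ((b == c) + (b == d)) <= 2)%N ->
  ((c == a) + (c == b) + ((c == c) + (c == d)) <= 2)%N ->
  ((d == a) + (d == b) + ((d == c) + (d == d)) <= 2)%N ->
  ~~ explicit_case a b c d -> ~~ explicit_case c d a b -> False.
Proof.
move=> ab cd; rewrite /explicit_case !eqxx.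
case: (ltngtP a c) => ac; case: (ltngtP b d) => bd; case: (ltngtP b c) => bc;
  case: (ltngtP a d) => ad; try lia.
all: move=> *; lia.
Qed.

Section IK.
Variables (K : fieldType) (q : K).
Local Notation W := (IKweight q).

(** Each of the three pairs of lines crosses exactly once on either side, so both sides have the
    same common denominator and the identity of numerators is enough. *)
Lemma IKweight_YBE (x y z : K) (a b d s t e : nat) :
  (a < 3)%N -> (b < 3)%N -> (d < 3)%N -> (s < 3)%N -> (t < 3)%N -> (e < 3)%N ->
  IKden q x y != 0 -> IKden q x z != 0 -> IKden q y z != 0 ->
  \sum_(k < 3) \sum_(l < 3) \sum_(m < 3) W x y a d k m * W x z b m l e * W y z l k s t =
  \sum_(k < 3) \sum_(l < 3) \sum_(m < 3) W y z b a l k * W x z l d s m * W x y k m t e.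
Proof.
move=> a3 b3 d3 s3 t3 e3 dxy dxz dyz.
set d3' := (IKden q x y * IKden q x z * IKden q y z)^-1.
transitivity (d3' * \sum_(k < 3) \sum_(l < 3) \sum_(m < 3)
    IKnum q x y a d k m * IKnum q x z b m l e * IKnum q y z l k s t).
  rewrite mulr_sumr; apply: eq_bigr => k _; rewrite mulr_sumr.
  apply: eq_bigr => l _; rewrite mulr_sumr; apply: eq_bigr => m _.
  by rewrite !IKweightE // /d3'; field; rewrite dxy dxz dyz.
rewrite YBnum // mulr_sumr; apply: eq_bigr => k _; rewrite mulr_sumr.
apply: eq_bigr => l _; rewrite mulr_sumr; apply: eq_bigr => m _.
by rewrite !IKweightE // /d3'; field; rewrite dxy dxz dyz.
Qed.

(** * Amplitudes of one row and of a pair of rows *)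

(* Row x, in horizontal state a, lowers its state by 1 (rho1) or 2 (rho2) while
   crossing column z: these are the weights divided by the weight for crossing
   with bottom and top states 0. *)
Definition rho1 (a : nat) (x z : K) : K :=
  match a with
  | 0 => 0
  | 1 => (1 - q ^+ 2) * z / (x - z)
  | _ => q * (1 - q) ^+ 2 * (1 + q) * z / (x - q * z)
  end.
Definition rho2 (a : nat) (x z : K) : K :=
  match a with
  | 0 | 1 => 0
  | _ => (1 - q ^+ 2) * (x + q ^+ 2 * x - q ^+ 2 * z - q ^+ 3 * z) * z / ((x - z) * (x - q * z))
  end.
(* The pair factors: [phi a b x y] when row x lowers from a to a-1 while row y
   stays in state b, [chi a b x y z] when both rows lower by 1 in column z.
   They are solved from the requirement that the products over the columns be
   Delta, with [phi a 0] normalised to 1. *)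
Definition phi (a b : nat) (x y : K) : K :=
  match a, b with
  | _, 0 | 0, _ => 1
  | 1, 1 => (y - q ^+ 2 * x) / ((y - x) * (y - q * x))
  | 1, _ => (y - q ^+ 3 * x) / (y - q * x)
  | _, 1 => y - q * x
  | _, _ => (y - q ^+ 2 * x) / (y - x)
  end.
Definition chi (a b : nat) (x y z : K) : K :=
  match a, b with
  | _, 0 | 0, _ => 0
  | 1, 1 => - ((x * y + q ^+ 2 * x * y - q ^+ 2 * (x + y) * z)
              / ((1 - q) * z * (y - q * x) * (x - q * y)))
  | 1, _ => (x * y + q ^+ 2 * x * y - q ^+ 2 * y * z - q ^+ 3 * x * z)
            / (q * (1 - q) * (y - x) * z)
  | _, 1 => (x * y + q ^+ 2 * x * y - q ^+ 2 * x * z - q ^+ 3 * y * z)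
            / (q * (1 - q) * (x - y) * z)
  | _, _ => - ((x * y + q ^+ 2 * x * y - q ^+ 3 * (x + y) * z)
            / (q * (1 - q) * z))
  end.
Definition rho11 a b x y z := rho1 a x z * rho1 b y z * chi a b x y z.
(* The weight for crossing in state a-1 over the one for crossing in state a. *)
Definition lamr (a : nat) (x z : K) : K :=
  match a with
  | 0 => 1
  | 1 => (x - q ^+ 2 * z) / (x - z)
  | _ => (x - q ^+ 3 * z) / (x - q * z)
  end.

(** All powers of q are excluded, in both directions, so that the relation survives dividing the
    second argument by q ([indep_divq]); this is how the auxiliary column y/q inherits genericity
    from y. *)
Definition indep (a b : K) : Prop :=
  forall k, (a - q ^+ k * b != 0) && (b - q ^+ k * a != 0).

Lemma indep_sym a b : indep a b -> indep b a.
Proof. by move=> ab k; rewrite andbC. Qed.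

Lemma indepl a b k : indep a b -> a - q ^+ k * b != 0.
Proof. by move=> /(_ k)/andP[]. Qed.

Lemma indep_nz a b : indep a b ->
  [/\ a - b != 0, a - q * b != 0, a - q ^+ 2 * b != 0, a - q ^+ 3 * b != 0
    & a * q - b != 0].
Proof.
move=> ab; have := indepl 0 ab; have := indepl 1 ab; have := indepl 2 ab.
have := indepl 3 ab; have := indepl 1 (indep_sym ab).
rewrite expr1 expr0 mul1r => H ? ? ? ?; split=> //.
by rewrite -opprB oppr_eq0 mulrC.
Qed.

Definition qgeneric : Prop := [/\ q != 0, 1 - q != 0 & 1 - q ^+ 2 != 0].
(** The weights of row y at column z have no pole. This is weaker than [indep y z] because it has to
    hold at z = y/q as well ([regular_w]). *)
Definition regular (y z : K) : Prop :=
  [/\ y != 0, z != 0, y - q ^+ 2 * z != 0 & y - q ^+ 3 * z != 0].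
Hypothesis Q : qgeneric.

Ltac nz H := case: (indep_nz H) => ? ? ? ? ?.

Lemma indep_divq x y w : y = q * w -> indep x y -> indep x w.
Proof.
move=> -> xy; case: Q => q0 _ _ k; have /andP[H H'] := xy k.-1; have /andP[_ H2] := xy k.+1.
apply/andP; split; last first.
  by move: H2; rewrite exprS -mulrA -mulrBr mulf_eq0 negb_or => /andP[].
case: k H {H' H2} => [_|k]; last by rewrite exprSr mulrA.
have /andP[_] := xy 1%N; rewrite expr1 -mulrBr mulf_eq0 negb_or => /andP[_].
by rewrite expr0 mul1r -opprB oppr_eq0.
Qed.

(* The coefficient identities are rational identities in five indeterminates,
   out of reach of a plain [field].  With y = q w all factors that involve a row x
   are written in the linear forms x - q^k w and q^k x - w, so that the common
   denominator stays small; the factors shared by all terms are made opaque. *)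
Section Coef.
Variables (y w z : K).
Hypotheses (yE : y = q * w) (reg : regular y z).

Let q0 : q != 0. Proof. by case: Q. Qed.
Let q1 : 1 - q != 0. Proof. by case: Q. Qed.
Let q2 : 1 + q != 0.
Proof.
case: Q => _ _; apply: contraNneq => E.
have -> : 1 - q ^+ 2 = (1 + q) * (1 - q) by ring.
by rewrite E mul0r.
Qed.
Let z0 : z != 0. Proof. by case: reg. Qed.
Let w0 : w != 0.
Proof. by case: reg => + _ _ _; rewrite yE mulf_eq0 negb_or => /andP[]. Qed.
Let w1 : w - q * z != 0.
Proof.
case: reg => _ _ + _; rewrite (_ : y - _ = q * (w - q * z)); last by rewrite yE; ring.
by rewrite mulf_eq0 negb_or => /andP[].
Qed.
Let w2 : w - q ^+ 2 * z != 0.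
Proof.
case: reg => _ _ _; rewrite (_ : y - _ = q * (w - q ^+ 2 * z)); last by rewrite yE; ring.
by rewrite mulf_eq0 negb_or => /andP[].
Qed.
Let y2 : q * w - q ^+ 2 * z != 0. Proof. by rewrite -yE; case: reg. Qed.
Let y3 : q * w - q ^+ 3 * z != 0. Proof. by rewrite -yE; case: reg. Qed.
Let d2 : q * w - q ^+ 2 * w != 0.
Proof. by have -> : q * w - q ^+ 2 * w = q * (1 - q) * w by [ring]; rewrite !mulf_neq0. Qed.
Let d3 : q * w - q ^+ 3 * w != 0.
Proof.
by have -> : q * w - q ^+ 3 * w = q * (1 - q) * (1 + q) * w by [ring]; rewrite !mulf_neq0.
Qed.

Ltac byfield := field; repeat (apply/andP; split); rewrite ?oppr_eq0 ?oner_neq0 //.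

Section Row.
Variable x : K.
Hypothesis xy : indep x y.
Let xw := indep_divq yE xy.
Let m1 : q * w - x != 0.
Proof. by rewrite -yE; case: (indep_nz (indep_sym xy)). Qed.
Let m2 : q * w - q * x != 0.
Proof. by rewrite -yE; case: (indep_nz (indep_sym xy)). Qed.
Let m3 : x - q * w != 0.
Proof. by rewrite -yE; case: (indep_nz xy). Qed.
Ltac cf := rewrite yE /phi /chi; nz xw; byfield.

Lemma phi11l : phi 1 1 x y = - ((q * x - w) / ((x - q * w) * (x - w))).
Proof. cf. Qed.
Lemma phi12l : phi 1 2 x y = (q ^+ 2 * x - w) / (x - w).
Proof. cf. Qed.
Lemma phi21l : phi 2 1 x y = - (q * (x - w)).
Proof. cf. Qed.
Lemma phi22l : phi 2 2 x y = q * (q * x - w) / (x - q * w).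
Proof. cf. Qed.
Lemma phi11r : phi 1 1 y x = (x - q ^+ 3 * w) / ((x - q * w) * (x - q ^+ 2 * w)).
Proof. cf. Qed.
Lemma phi12r : phi 1 2 y x = (x - q ^+ 4 * w) / (x - q ^+ 2 * w).
Proof. cf. Qed.
Lemma phi21r : phi 2 1 y x = x - q ^+ 2 * w.
Proof. cf. Qed.
Lemma phi22r : phi 2 2 y x = (x - q ^+ 3 * w) / (x - q * w).
Proof. cf. Qed.
Lemma chi12l : chi 1 2 x y z =
  - (((1 + q ^+ 2) * x * w - q ^+ 2 * (x + w) * z) / ((1 - q) * (x - q * w) * z)).
Proof. cf. Qed.
Lemma chi22l : chi 2 2 x y z =
  - (((1 + q ^+ 2) * x * w - q ^+ 2 * (x + q * w) * z) / ((1 - q) * z)).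
Proof. cf. Qed.
Lemma chi12w : chi 1 2 x y w = - ((x - q ^+ 2 * w) / ((1 - q) * (x - q * w))).
Proof. cf. Qed.
Lemma chi22w : chi 2 2 x y w = - ((x - q ^+ 3 * w) / (1 - q)).
Proof. cf. Qed.
End Row.

(** These collect the denominators of the weights of row y at column z, written in w. In
    [coef_T2_one_pair] every term carries exactly [k * i], so both can be generalised there. *)
Let k := (q * w - z) / (w - q * z).
Let i := (w - q ^+ 2 * z)^-1.
Ltac cf := rewrite ?yE /IKweight /k /i; byfield.

Lemma W0202z : W y z 0 2 0 2 = k * i * ((w - z) / q).
Proof. cf. Qed.
Lemma W0211z : W y z 0 2 1 1 = k * i * ((1 - q) ^+ 2 * (1 + q) * z / q).
Proof. cf. Qed.
Lemma W0220z : W y z 0 2 2 0 =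
  (1 - q ^+ 2) * ((1 + q ^+ 2) * w - q * (1 + q) * z) * z / (q * (w - q * z)) * i.
Proof. cf. Qed.
Lemma W0101z : W y z 0 1 0 1 = k / q.
Proof. cf. Qed.
Lemma W0110z : W y z 0 1 1 0 = (1 - q ^+ 2) * z / (q * (w - q * z)).
Proof. cf. Qed.
Lemma W1212z : W y z 1 2 1 2 = k / q.
Proof. cf. Qed.
Lemma W1221z : W y z 1 2 2 1 = (1 - q ^+ 2) * z / (q * (w - q * z)).
Proof. cf. Qed.
Lemma W2112z : W y z 2 1 1 2 = (1 - q ^+ 2) * w / (w - q * z).
Proof. cf. Qed.
Lemma W1102z : W y z 1 1 0 2 = k * i * ((1 + q) * w / q).
Proof. cf. Qed.
Lemma W1111z : W y z 1 1 1 1 =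
  (- (q ^+ 2 * w ^+ 2) + (1 + q) * (1 - q ^+ 2 + q ^+ 4) * w * z - q ^+ 3 * z ^+ 2)
  / (q * (w - q * z)) * i.
Proof. cf. Qed.
Lemma W1221wz : W w z 1 2 2 1 = (1 - q ^+ 2) * z * i.
Proof. by []. Qed.
Lemma W2121wz : W w z 2 1 2 1 = q ^+ 2 * (w - z) * i.
Proof. by []. Qed.
Lemma W0211w : W y w 0 2 1 1 = - ((1 - q) / q).
Proof. cf. Qed.
Lemma W0101w : W y w 0 1 0 1 = - q^-1.
Proof. cf. Qed.
Lemma W0110w : W y w 0 1 1 0 = (1 + q) / q.
Proof. cf. Qed.
Lemma W0220w : W y w 0 2 2 0 = q^-1.
Proof. cf. Qed.

(** The constants of [rho1] in states 1 and 2. In a pair identity every term has one [rho1] factor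
    for each of the two rows, so the constants cancel and may be generalised. *)
Let c1 := 1 - q ^+ 2.
Let c2 := q * (1 - q) ^+ 2 * (1 + q).
Lemma rho1_0 x u : rho1 0 x u = 0. Proof. by []. Qed.
Lemma rho1_1 x u : rho1 1 x u = c1 * (u / (x - u)).
Proof. by rewrite mulrA. Qed.
Lemma rho1_2 x u : rho1 2 x u = c2 * (u / (x - q * u)).
Proof. by rewrite mulrA. Qed.

Ltac canon H := rewrite ?(phi11l H) ?(phi12l H) ?(phi21l H) ?(phi22l H) ?(phi11r H) ?(phi12r H)
  ?(phi21r H) ?(phi22r H) ?(chi12l H) ?(chi22l H) ?(chi12w H) ?(chi22w H).
Ltac canonW := rewrite ?W0202z ?W0211z ?W0220z ?W0101z ?W0110z ?W1212z ?W1221z ?W2112z ?W1102z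
  ?W1111z ?W1221wz ?W2121wz ?W0211w ?W0101w ?W0110w ?W0220w.

Ltac single xy xz := canon xy; canonW; rewrite /rho1 /rho2 /phi /chi /lamr /k /i /= ?yE;
  nz xz; nz (indep_divq yE xy); have ? := indepl 4 (indep_divq yE xy);
  case: (indep_nz (indep_sym xy)); case: (indep_nz xy);
  rewrite yE => ? ? ? ? ? ? ? ? ? ?; byfield.

(** In these names T_s acts on f_{h,2} ([two]) or f_{h,1} ([one]); [single], [double] and [pair]
    mean that one old row is lowered by one, one old row by two, or two old rows by one each. Each
    identity is what remains of a comparison of coefficients once the common factors are removed.
    Those for T_2 on f_{h,1} come from the exchange relation and therefore involve both columns z
    and w. *)
Lemma coef_T1_two_single x a : indep x y -> indep x z ->
  (a < 3)%N -> W y z 1 2 1 2 * rho1 a x z = W y z 0 2 1 1 * (rho1 a x w / (1 - q)) +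
    rho1 a x z * phi a 2 x y * W y z 0 2 0 2.
Proof. move=> xy xz; case: a => [|[|[|a]]] // _; single xy xz. Qed.

Lemma coef_T0_one_single x a : indep x y -> indep x z ->
  (a < 3)%N -> W y z 0 2 0 2 * (rho1 a x w / (1 - q)) * lamr a x z + W y z 1 1 0 2 * rho1 a x z
  = W y z 0 1 0 1 * (rho1 a x w / (1 - q)).
Proof. move=> xy xz; case: a => [|[|[|a]]] // _; single xy xz. Qed.

Lemma coef_T2_two_single x a : indep x y -> indep x z ->
  (a < 3)%N -> W y z 1 2 2 1 * rho1 a x z = W y z 0 2 2 0 * rho1 a x y +
   rho1 a x z * chi a 2 x y z * W y z 0 2 1 1 / phi 2 a.-1 y x.
Proof. move=> xy xz; case: a => [|[|[|a]]] // _; single xy xz. Qed.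

Lemma coef_T1_one_single x a : indep x y -> indep x z ->
  (a < 3)%N -> W y z 1 1 1 1 * rho1 a x z + W y z 0 2 1 1 * (rho1 a x w / (1 - q)) *
    lamr a x z =
  W y z 0 1 1 0 * rho1 a x y + rho1 a x z * phi a 1 x y * W y z 0 1 0 1 *
    (phi 2 a y x / phi 2 a.-1 y x).
Proof. move=> xy xz; case: a => [|[|[|a]]] // _; single xy xz. Qed.

Lemma coef_T2_one_single x a : indep x y -> indep x z ->
  (a < 3)%N ->
  (rho1 a x z * chi a 2 x y z * W y z 0 2 1 1 / phi 2 a y x) * lamr a x w * W y w 0 1 1 0 *
    (phi 1 a.-1 y x / phi 1 a y x)
  + W y z 0 2 2 0 * rho1 a x w - W w z 1 2 2 1 *
  ((rho1 a x w * chi a 2 x y w * W y w 0 2 1 1 / phi 2 a y x) * lamr a x z * W y z 0 1 1 0 *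
    (phi 1 a.-1 y x / phi 1 a y x)
  + W y w 0 2 2 0 * rho1 a x z)
  = W w z 2 1 2 1 * W y w 0 2 1 1 * (rho1 a x z * chi a 1 x y z * W y z 0 1 1 0 / phi 1 a y x).
Proof. move=> xy xz; case: a => [|[|[|a]]] // _; single xy xz. Qed.

Lemma coef_T2_two_double x : indep x y -> indep x z ->
  rho2 2 x z = W y z 0 2 2 0 * rho2 2 x y + rho1 2 x z * chi 2 2 x y z *
    W y z 0 2 1 1 / phi 2 1 y x * (rho1 1 x w / (1 - q))
   + rho2 2 x z * (phi 2 2 x y * phi 1 2 x y) * W y z 0 2 0 2.
Proof. by move=> xy xz; single xy xz. Qed.

Lemma coef_T1_one_double x : indep x y -> indep x z ->
  W y z 1 2 1 2 * (rho1 2 x w / (1 - q)) * lamr 2 x z * rho1 1 x z +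
    W y z 2 1 1 2 * rho2 2 x z =
   W y z 0 1 1 0 * rho2 2 x y + rho1 2 x z * phi 2 1 x y * W y z 0 1 0 1 *
     (phi 2 2 y x / phi 2 1 y x) * (rho1 1 x w / (1 - q)).
Proof. by move=> xy xz; single xy xz. Qed.

Lemma coef_T2_one_double x : indep x y -> indep x z ->
  rho2 2 x z * (phi 2 2 x y * phi 1 2 x y) * W y z 0 2 0 2 * W y w 0 2 1 1 * (lamr 2 x w *
    lamr 1 x w) / phi 2 2 y x
  + (rho1 2 x z * chi 2 2 x y z * W y z 0 2 1 1 / phi 2 2 y x) * lamr 2 x w * rho1 1 x w *
    phi 1 1 x y * W y w 0 1 0 1
  - W w z 1 2 2 1 *
   ((rho1 2 x w * chi 2 2 x y w * W y w 0 2 1 1 / phi 2 2 y x) * lamr 2 x z * rho1 1 x z *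
     phi 1 1 x y * W y z 0 1 0 1)
  = W w z 2 1 2 1 * W y w 0 2 1 1 * (rho2 2 x z * (phi 2 1 x y * phi 1 1 x y) * W y z 0 1 0 1).
Proof. by move=> xy xz; single xy xz. Qed.

Ltac pair opaque_ki x1 x2 xx xy xy' xz xz' :=
  canon xy; canon xy'; canonW; rewrite /rho11 ?rho1_1 ?rho1_2;
  generalize c1 c2 => ? ?; opaque_ki;
  rewrite /phi /chi /lamr /= ?yE -?[x2 - x1]opprB;
  nz xx; nz (indep_sym xx); nz xz; nz (indep_divq yE xy); case: (indep_nz xy);
  nz xz'; nz (indep_divq yE xy'); case: (indep_nz xy');
  rewrite yE => ? ? ? ? ? ? ? ? ? ?; byfield.

Lemma coef_T2_two_pair x1 x2 a b : indep x1 x2 ->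
  indep x1 y -> indep x2 y -> indep x1 z -> indep x2 z ->
  (a < 3)%N -> (b < 3)%N ->
  rho11 a b x1 x2 z = W y z 0 2 2 0 * rho11 a b x1 x2 y +
  (rho1 a x1 z * chi a 2 x1 y z * W y z 0 2 1 1 / phi 2 a.-1 y x1 * (rho1 b x2 w / (1 - q)) *
    (phi a b x1 x2 * phi b a.-1 x2 x1) +
  rho1 b x2 z * chi b 2 x2 y z * W y z 0 2 1 1 / phi 2 b.-1 y x2 * (rho1 a x1 w / (1 - q)) *
    (phi b a x2 x1 * phi a b.-1 x1 x2))
  + rho11 a b x1 x2 z * (phi a 2 x1 y * phi b 2 x2 y) * W y z 0 2 0 2.
Proof.
move=> xx xy xy' xz xz'; case: a => [|[|[|a]]] // _; case: b => [|[|[|b]]] // _;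
  try (rewrite /rho11 !rho1_0; ring); pair ltac:(rewrite /k /i) x1 x2 xx xy xy' xz xz'.
Qed.

Lemma coef_T1_one_pair x1 x2 a b : indep x1 x2 ->
  indep x1 y -> indep x2 y -> indep x1 z -> indep x2 z ->
  (a < 3)%N -> (b < 3)%N ->
  W y z 1 2 1 2 * (rho1 a x1 w / (1 - q) * lamr a x1 z * rho1 b x2 z * (phi a b x1 x2 *
    phi b a.-1 x2 x1) +
      rho1 b x2 w / (1 - q) * lamr b x2 z * rho1 a x1 z * (phi b a x2 x1 * phi a b.-1 x1 x2)) +
        W y z 2 1 1 2 * rho11 a b x1 x2 z =
  W y z 0 1 1 0 * rho11 a b x1 x2 y +
  (rho1 a x1 z * phi a 1 x1 y * W y z 0 1 0 1 * (phi 2 a y x1 / phi 2 a.-1 y x1) *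
    (rho1 b x2 w / (1 - q)) * (phi a b x1 x2 * phi b a.-1 x2 x1) +
   rho1 b x2 z * phi b 1 x2 y * W y z 0 1 0 1 * (phi 2 b y x2 / phi 2 b.-1 y x2) *
     (rho1 a x1 w / (1 - q)) * (phi b a x2 x1 * phi a b.-1 x1 x2)).
Proof.
move=> xx xy xy' xz xz'; case: a => [|[|[|a]]] // _; case: b => [|[|[|b]]] // _;
  try (rewrite /rho11 !rho1_0; ring); pair ltac:(rewrite /k /i) x1 x2 xx xy xy' xz xz'.
Qed.

Lemma coef_T2_one_pair x1 x2 a b : indep x1 x2 ->
  indep x1 y -> indep x2 y -> indep x1 z -> indep x2 z ->
  (a < 3)%N -> (b < 3)%N ->
  rho11 a b x1 x2 z * (phi a 2 x1 y * phi b 2 x2 y) * W y z 0 2 0 2 * W y w 0 2 1 1 *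
    (lamr a x1 w * lamr b x2 w) *
    ((phi 2 a.-1 y x1 / phi 2 a y x1) * (phi 2 b.-1 y x2 / phi 2 b y x2))
  + ((rho1 a x1 z * chi a 2 x1 y z * W y z 0 2 1 1 / phi 2 a y x1) * lamr a x1 w *
    rho1 b x2 w * phi b 1 x2 y * W y w 0 1 0 1 * (phi a b x1 x2 * phi b a.-1 x2 x1)
   + (rho1 b x2 z * chi b 2 x2 y z * W y z 0 2 1 1 / phi 2 b y x2) * lamr b x2 w *
     rho1 a x1 w * phi a 1 x1 y * W y w 0 1 0 1 * (phi b a x2 x1 * phi a b.-1 x1 x2))
  - W w z 1 2 2 1 *
   ((rho1 a x1 w * chi a 2 x1 y w * W y w 0 2 1 1 / phi 2 a y x1) * lamr a x1 z * rho1 b x2 z *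
     phi b 1 x2 y * W y z 0 1 0 1 * (phi a b x1 x2 * phi b a.-1 x2 x1)
   + (rho1 b x2 w * chi b 2 x2 y w * W y w 0 2 1 1 / phi 2 b y x2) * lamr b x2 z *
     rho1 a x1 z * phi a 1 x1 y * W y z 0 1 0 1 * (phi b a x2 x1 * phi a b.-1 x1 x2))
  = W w z 2 1 2 1 * W y w 0 2 1 1 * (rho11 a b x1 x2 z * (phi a 1 x1 y * phi b 1 x2 y) *
    W y z 0 1 0 1).
Proof.
move=> xx xy xy' xz xz'; case: a => [|[|[|a]]] // _; case: b => [|[|[|b]]] // _;
  try (rewrite /rho11 !rho1_0; ring); pair ltac:(generalize k i => ? ?) x1 x2 xx xy xy' xz xz'.
Qed.

End Coef.

Section Col.
Variable x : nat -> K.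

(** * Column operators *)

Fixpoint colw n (s : nat) (z : K) (g g' : nat -> nat) : K :=
  if n is m.+1 then \sum_(k < 3) colw m k z g g' * W (x m) z k (g m) s (g' m)
  else (s == 0)%:R.

Definition colb N (s : nat) (z : K) (v g g' : nat -> nat) : K :=
  (v 0 == 0)%:R * (v N == s)%:R * \prod_(r < N) W (x r) z (v r) (g r) (v r.+1) (g' r).

Lemma colwE N s z g g' : (s < 3)%N -> colw N s z g g' = fsum N.+1 (fun v => colb N s z v g g').
Proof.
elim: N s => [|N IH] s s3.
  rewrite /colb /= !big_ord_recl !big_ord0 /= !mulr1 /upd eqxx /= !mul0r !addr0 mul1r.
  by rewrite eq_sym.
rewrite [RHS]/= (bigD1 (Ordinal s3)) //= [X in _ + X]big1 ?addr0; last first.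
  move=> j; rewrite -val_eqE /= => /negPf js; rewrite -[RHS](fsum0 K N.+1) /=.
  apply: eq_bigr => j' _; apply: eq_fsum => g0 _.
  by rewrite /colb /upd eqxx js mulr0 mul0r.
rewrite -[RHS]/(fsum N.+1 (fun v => colb N.+1 s z (upd v N.+1 s) g g')).
under eq_bigr => k _ do rewrite (IH k) // -fsumMr.
rewrite -fsum_sum; apply: eq_fsum => v [v3 v0].
rewrite (bigD1 (Ordinal (v3 N))) //= big1 ?addr0; last first.
  by move=> j; rewrite -val_eqE /= eq_sym => /negPf jv; rewrite /colb jv mulr0 !mul0r.
have u1 : upd v N.+1 s N.+1 = s by rewrite /upd eqxx.
have u2 k : (k <= N)%N -> upd v N.+1 s k = v k by move=> kN; rewrite /upd ltn_eqF.
rewrite /colb big_ord_recr /= u1 !u2 // !eqxx !mulr1 -!mulrA; congr (_ * (_ * _)).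
by apply: eq_bigr => r _; rewrite !u2 // ltnW.
Qed.

(** The partition function with an arbitrary left boundary g: a recursion on columns cannot keep the
    boundary state 2. *)
Fixpoint Zf N L (S : nat -> nat) (z : nat -> K) (g : nat -> nat) : K :=
  if L is l.+1 then
    fsum N (fun g' => colw N (S 0) (z 0) g g' * Zf N l (fun c => S c.+1) (fun c => z c.+1) g')
  else (agree N g (fun=> 0%N))%:R.

Definition Qbody (N L : nat) (H V : nat -> nat -> nat) (S : nat -> nat) (z : nat -> K) : K :=
  (agree N (H L) (fun=> 0%N))%:R *
  \prod_(c < L) colb N (S c) (z c) (V c) (H c) (H c.+1).

Lemma ZfE N L S z g : (forall c, (S c < 3)%N) ->
  mxsum N L (fun M => mxsum N.+1 L (fun V => Qbody N L (ccons g M) V S z)) = Zf N L S z g.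
Proof.
elim: L S z g => [|L IH] S z g S3.
  by rewrite /= /Qbody big_ord0 mulr1.
transitivity (fsum N (fun g' => mxsum N L (fun M => fsum N.+1 (fun v => mxsum N.+1 L (fun V =>
  Qbody N L.+1 (ccons g (ccons g' M)) (ccons v V) S z))))); first by [].
rewrite [RHS]/=; apply: eq_fsum => g' _; rewrite -IH // colwE // -fsumMr mxsum_fsum_exch.
apply: eq_fsum => v _.
rewrite -mxsumMl; apply: eq_mxsum => M _; rewrite -mxsumMl; apply: eq_mxsum => V _.
by rewrite /Qbody big_ord_recl /= mulrCA.
Qed.
End Col.

Definition extend N (x : 'I_N -> K) : nat -> K := fun k => oapp x 0 (insub k).
Definition twos N : nat -> nat := fun k => if (k < N)%N then 2 else 0.

Lemma twos_small N : small N (twos N).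
Proof. by split=> k; rewrite /twos; [case: ifP|move/leq_gtF->]. Qed.

(** The boundary conditions are turned into 0/1 factors, those of a column going into [colb]; the
    sum over configurations then factors column by column. *)
Lemma IKF_Zf N L S (x : 'I_N -> K) z : (forall c, (S c < 3)%N) ->
  IKF q L S x z = Zf (extend x) N L S z (twos N).
Proof.
move=> S3; rewrite -ZfE //.
rewrite -(fsum_pick (fun g => mxsum N L (fun M => mxsum N.+1 L (fun V =>
   Qbody (extend x) N L (ccons g M) V S z))) (twos_small N)).
transitivity (mxsum N L.+1 (fun H => mxsum N.+1 L (fun V =>
  (agree N (H 0) (twos N))%:R * Qbody (extend x) N L H V S z))); last first.
  rewrite /=; apply: eq_fsum => g _; rewrite -mxsumMl; apply: eq_mxsum => M _.
  by rewrite -mxsumMl; apply: eq_mxsum => V _.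
rewrite -sum_mx; apply: eq_bigr => h _; rewrite -sum_mx big_mkcond.
apply: eq_bigr => v _.
have -> : boundary S h v = [&& agree N (mfun h 0) (twos N), agree N (mfun h L) (fun=> 0%N)
   & [forall c : 'I_L, (mfun v c 0 == 0) && (mfun v c N == S c)]]%N.
  rewrite /boundary; congr [&& _, _ & _].
  - by apply: eq_forallb => r; rewrite -(mfunE h) /twos ltn_ord.
  - by apply: eq_forallb => r; rewrite -(mfunE h).
  - apply/andP/forallP => [[/forallP v0 /forallP vN] c|E].
      by move: (v0 c) (vN c); rewrite -!mfunE /= => -> ->.
    by split; apply/forallP => c; move/andP: (E c) => []; rewrite -!mfunE.
rewrite /Qbody; case: (agree N (mfun h 0) _); last by rewrite mul0r.
case: (agree N (mfun h L) _); last by rewrite mul0r mulr0.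
rewrite !mul1r /= /colb.
case: forallP => [E|E].
  rewrite /config_weight exchange_big /=; apply: eq_bigr => c _.
  have /andP[-> ->] := E c; rewrite !mul1r; apply: eq_bigr => r _.
  by rewrite -!mfunE /extend valK /= /bump !add1n.
have [c cE] : exists c : 'I_L, ~~ ((mfun v c 0 == 0) && (mfun v c N == S c))%N.
  by apply/existsP; rewrite -negb_forall; apply/negP => /forallP.
rewrite (bigD1 c) //= -natrM mulnb (negPf cE) !mul0r //.
Qed.

(** The n-fold tensor power as iterated triples: the components along the top row are projections,
    and induction on rows is structural. *)
Fixpoint colsp (n : nat) : lmodType K :=
  if n is m.+1 then (colsp m * colsp m * colsp m)%type else K^o.

Definition part n (j : nat) (v : colsp n.+1) : colsp n :=
  match j with 0 => v.1.1 | 1 => v.1.2 | _ => v.2 end.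
Definition tri n (F : nat -> colsp n) : colsp n.+1 := (F 0%N, F 1%N, F 2%N).

Lemma part_tri n (F : nat -> colsp n) j : (j < 3)%N -> part j (tri F) = F j.
Proof. by case: j => [|[|[|j]]]. Qed.
Lemma part_inj n (v w : colsp n.+1) : (forall j, (j < 3)%N -> part j v = part j w) -> v = w.
Proof.
case: v w => [[a b] c] [[a' b'] c'] E.
by move: (E 0%N isT) (E 1%N isT) (E 2%N isT); rewrite /= => -> -> ->.
Qed.

Lemma part_is_linear n j : linear (@part n j).
Proof. by move=> a [[? ?] ?] [[? ?] ?]; case: j => [|[|j]]. Qed.
Lemma partP n j a (v w : colsp n.+1) : part j (a *: v + w) = a *: part j v + part j w.
Proof. exact: part_is_linear. Qed.
HB.instance Definition _ n j :=
  GRing.isLinear.Build K (colsp n.+1) (colsp n) *:%R (@part n j) (@part_is_linear n j).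

Section Rows.
Variable x : nat -> K.

(* Bottom state 0, top state s; the last factor of the tensor product is the
   top row. *)
Fixpoint colop n (s : nat) (z : K) : colsp n -> colsp n :=
  match n return colsp n -> colsp n with
  | 0 => fun v => if s == 0%N then v else 0
  | m.+1 => fun v => tri (fun l => \sum_(k < 3) \sum_(j < 3)
      W (x m) z k j s l *: colop k z (part j v))
  end.

Lemma colop_is_linear n s z : linear (@colop n s z).
Proof.
elim: n s => [|n IH] s a v w /=; first by case: ifP; rewrite ?scaler0 ?addr0.
apply: part_inj => l l3; rewrite partP !part_tri //.
rewrite scaler_sumr -big_split; apply: eq_bigr => k _ /=.
rewrite scaler_sumr -big_split; apply: eq_bigr => j _ /=.
by rewrite partP IH scalerDr !scalerA [_ * a]mulrC.
Qed.

HB.instance Definition _ n s z :=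
  GRing.isLinear.Build K (colsp n) (colsp n) *:%R (@colop n s z) (@colop_is_linear n s z).

Lemma part_col n s z (v : colsp n.+1) l : (l < 3)%N ->
  part l (colop s z v) = \sum_(k < 3) \sum_(j < 3) W (x n) z k j s l *: colop k z (part j v).
Proof. by move=> l3; rewrite /= part_tri. Qed.

(** The exchange relations, by induction on rows: the Yang-Baxter equation carries the weight of the
    two columns through the top row, and the induction hypothesis carries it through the rows below.
    With no row left, only [W y z 0 0 s t] remains, which is 1 for s = t = 0 and 0 otherwise. *)
Lemma colop_RTT n y z (v : colsp n) s t :
    (forall i, (i < n)%N -> IKden q (x i) y != 0) ->
    (forall i, (i < n)%N -> IKden q (x i) z != 0) -> IKden q y z != 0 ->
    (s < 3)%N -> (t < 3)%N ->
  \sum_(a < 3) \sum_(b < 3) W y z b a s t *: colop b z (colop a y v) = colop t y (colop s z v).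
Proof.
move=> + + dyz; elim: n v s t => [|n IH] v s t dxy dxz s3 t3.
  rewrite !big_ord_recl !big_ord0 /= !(scaler0, addr0).
  by case: s t s3 t3 => [|[|[|s]]] [|[|[|t]]] //= _ _; rewrite ?scale1r ?scale0r ?addr0.
have {}IH v' s' t' : (s' < 3)%N -> (t' < 3)%N -> \sum_(a < 3) \sum_(b < 3)
    W y z b a s' t' *: colop b z (colop a y v') = @colop n t' y (colop s' z v').
  by apply: IH => i ni; [apply: dxy|apply: dxz]; apply: leqW.
pose U (a b d : 'I_3) : colsp n := colop b z (colop a y (part d v)).
have E1 a b e : (a < 3)%N -> (b < 3)%N -> (e < 3)%N -> part e (colop b z (colop a y v)) =
    \sum_(a1 < 3) \sum_(b1 < 3) \sum_(d < 3) \sum_(m < 3)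
      (W (x n) y a1 d a m * W (x n) z b1 m b e) *: U a1 b1 d.
  move=> a3 b3 e3; rewrite part_col // exchange_big /=.
  rewrite [RHS](eq_bigr (fun a1 : 'I_3 => \sum_(m < 3) \sum_(b1 < 3) \sum_(d < 3)
      (W (x n) y a1 d a m * W (x n) z b1 m b e) *: U a1 b1 d)); last first.
    move=> a1 _; rewrite [RHS]exchange_big /=; apply: eq_bigr => b1 _.
    by rewrite [RHS]exchange_big.
  rewrite [RHS]exchange_big; apply: eq_bigr => m _ /=.
  rewrite [RHS]exchange_big; apply: eq_bigr => b1 _ /=.
  rewrite part_col // linear_sum scaler_sumr; apply: eq_bigr => a1 _.
  rewrite linear_sum scaler_sumr; apply: eq_bigr => d _.
  by rewrite linearZ scalerA mulrC.
apply: part_inj => e e3.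
rewrite linear_sum.
(* Both sides are brought to a combination of the vectors [U a1 b1 d], whose coefficients are the
   two sides of the Yang-Baxter equation. *)
transitivity (\sum_(d < 3) \sum_(a1 < 3) \sum_(b1 < 3)
   (\sum_(k < 3) \sum_(l < 3) \sum_(m < 3)
      W (x n) y a1 d k m * W (x n) z b1 m l e * W y z l k s t)
    *: U a1 b1 d).
  rewrite [RHS]exchange_big.
  under [RHS]eq_bigr => a1 _ do rewrite exchange_big.
  under [RHS]eq_bigr => a1 _.
    under eq_bigr => b1 _.
      under eq_bigr => d _ do rewrite scaler_suml.
      rewrite exchange_big; over.
    rewrite exchange_big; over.
  rewrite exchange_big; apply: eq_bigr => k _ /=.
  rewrite linear_sum.
  under [RHS]eq_bigr => a1 _.
    under eq_bigr => b1 _.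
      under eq_bigr => d _ do rewrite scaler_suml.
      rewrite exchange_big; over.
    rewrite exchange_big; over.
  rewrite exchange_big; apply: eq_bigr => l _ /=.
  rewrite linearZ /= E1 // scaler_sumr; apply: eq_bigr => a1 _.
  rewrite scaler_sumr; apply: eq_bigr => b1 _.
  rewrite scaler_sumr; apply: eq_bigr => d _.
  rewrite scaler_sumr scaler_suml; apply: eq_bigr => m _.
  by rewrite scalerA mulrC.
under eq_bigr => d _.
  under eq_bigr => a1 _.
    under eq_bigr => b1 _.
      rewrite IKweight_YBE ?ltn_ord //; [|exact: dxy|exact: dxz].
      over.
    over.
  over.
rewrite part_col //.
rewrite [RHS](eq_bigr (fun k : 'I_3 => \sum_(l < 3) \sum_(m < 3)
  \sum_(d < 3) \sum_(a1 < 3) \sum_(b1 < 3)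
    (W y z b1 a1 l k * W (x n) z l d s m * W (x n) y k m t e) *: U a1 b1 d)); last first.
  move=> k _; rewrite [RHS]exchange_big; apply: eq_bigr => m _ /=.
  rewrite part_col // linear_sum scaler_sumr; apply: eq_bigr => l _ /=.
  rewrite linear_sum scaler_sumr; apply: eq_bigr => d _ /=.
  rewrite linearZ /= -IH // !scaler_sumr; apply: eq_bigr => a1 _.
  rewrite !scaler_sumr; apply: eq_bigr => b1 _; rewrite !scalerA.
  by congr (_ *: _); ring.
under [RHS]eq_bigr => k _.
  under eq_bigr => l _ do rewrite exchange_big /=.
  rewrite exchange_big; over.
rewrite [RHS]exchange_big; apply: eq_bigr => d _ /=.
under [RHS]eq_bigr => k _.
  under eq_bigr => l _.
    rewrite exchange_big; over.
  rewrite exchange_big; over.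
rewrite [RHS]exchange_big; apply: eq_bigr => a1 _ /=.
under [RHS]eq_bigr => k _.
  under eq_bigr => l _ do rewrite exchange_big /=.
  rewrite exchange_big; over.
rewrite [RHS]exchange_big; apply: eq_bigr => b1 _ /=.
rewrite scaler_suml; apply: eq_bigr => k _; rewrite scaler_suml; apply: eq_bigr => l _.
by rewrite scaler_suml.
Qed.

Definition dec (h : nat -> nat) (i : nat) : nat -> nat :=
  fun k => if k == i then (h k).-1 else h k.

Lemma decE h i : dec h i i = (h i).-1. Proof. by rewrite /dec eqxx. Qed.
Lemma dec_neq h i k : k != i -> dec h i k = h k. Proof. by rewrite /dec => /negPf->. Qed.
Lemma decC h i j : dec (dec h i) j = dec (dec h j) i.
Proof. by apply: funext => k; rewrite /dec; case: eqP; case: eqP. Qed.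
Lemma dec_lt3 h i : (forall k, (h k < 3)%N) -> forall k, (dec h i k < 3)%N.
Proof.
by move=> h3 k; rewrite /dec; case: ifP => // _; apply: leq_ltn_trans (leq_pred _) _.
Qed.

(** * The basis *)

(** [lam] is the eigenvalue of T_0. [psi n a] collects the pair factors of the new row x n, lowered
    from state a, with the old rows; [Phi] does so for an old row i, and [Phi2] for two rows i, j
    without the factor of the pair (i, j) itself. *)
Definition lam n (h : nat -> nat) (z : K) : K := \prod_(k < n) W (x k) z 0 (h k) 0 (h k).
Definition psi n a (h : nat -> nat) : K := \prod_(k < n) phi a (h k) (x n) (x k).
Definition Phi n (h : nat -> nat) (i : nat) : K :=
  \prod_(k < n | k != i :> nat) phi (h i) (h k) (x i) (x k).
Definition Phi2 n (h : nat -> nat) (i j : nat) : K :=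
  \prod_(k < n | (k != i :> nat) && (k != j :> nat))
    (phi (h i) (h k) (x i) (x k) * phi (h j) (h k) (x j) (x k)).

Definition tau1 n h i z := lam n h z * rho1 (h i) (x i) z * Phi n h i.
Definition tau2 n h i z := lam n h z * rho2 (h i) (x i) z * (Phi n h i * Phi n (dec h i) i).
Definition tau11 n h i j z := lam n h z * rho11 (h i) (h j) (x i) (x j) z * Phi2 n h i j.

(* Component l on the new top row x n of the basis vector with that row in state
   j; the case j = 1 is T_1(x n / q) applied to the case j = 2, rescaled. *)
Definition fcomp n (F : (nat -> nat) -> colsp n) (j l : nat) (h : nat -> nat) : colsp n :=
  match j, l with
  | 0, _ => colop l (x n) (F h)
  | 1, 0 => 0
  | 1, 1 => (psi n 2 h)^-1 *: F h
  | 1, _ => \sum_(i < n) ((psi n 2 h)^-1 * (rho1 (h i) (x i) (x n / q) / (1 - q)) * Phi n h i)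
              *: F (dec h i)
  | _, 2 => F h
  | _, _ => 0
  end.

Fixpoint fvec n (h : nat -> nat) : colsp n :=
  match n return colsp n with
  | 0 => 1 : K
  | m.+1 => tri (fun l => fcomp (@fvec m) (h m) l h)
  end.

Definition col_generic n z := z != 0 /\ forall i, (i < n)%N -> indep (x i) z.
Definition rows_generic n := forall i, (i < n)%N ->
  x i != 0 /\ forall j, (j < n)%N -> i != j -> indep (x i) (x j).

Lemma col_genericS n z : col_generic n.+1 z -> col_generic n z.
Proof. by case=> z0 H; split=> // i ni; apply: H; apply: leqW. Qed.

Lemma prod_dec (g : nat -> nat -> K) n h i : (i < n)%N -> g i (h i) != 0 ->
  \prod_(k < n) g k (dec h i k) = \prod_(k < n) g k (h k) * (g i (h i).-1 / g i (h i)).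
Proof.
move=> ni gi; rewrite (bigD1 (Ordinal ni)) //= [in RHS](bigD1 (Ordinal ni)) //= decE.
rewrite [RHS]mulrC mulrA divfK //; congr (_ * _); apply: eq_bigr => k /= ki.
by rewrite dec_neq.
Qed.

Lemma lam_nz a u z : indep u z -> (a < 3)%N -> W u z 0 a 0 a != 0.
Proof.
move=> uz; case: (indep_nz uz) => ? ? ? ? ?.
by case: a => [|[|[|a]]] // _; rewrite /IKweight /= ?oner_neq0 // !mulf_neq0 ?invr_eq0
  ?mulf_neq0.
Qed.

Lemma lamrE a u z : indep u z -> (a < 3)%N -> W u z 0 a.-1 0 a.-1 / W u z 0 a 0 a = lamr a u z.
Proof.
move=> uz; case: (indep_nz uz) => ? ? ? ? ?; have o0 := oner_neq0 K.
case: a => [|[|[|a]]] // _; rewrite /IKweight /lamr /=; field;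
 repeat (apply/andP; split); done.
Qed.

Lemma phi_nz a b u v : indep u v -> phi a b u v != 0.
Proof.
move=> /indep_sym uv; case: (indep_nz uv) => ? ? ? ? ?; have o0 := oner_neq0 K.
by case: a => [|[|a]]; case: b => [|[|b]] //=; rewrite ?mulf_neq0 ?invr_eq0 ?mulf_neq0.
Qed.

Lemma lamN0 n h z : col_generic n z -> (forall k, (h k < 3)%N) -> lam n h z != 0.
Proof. by move=> [_ zo] h3; apply/prodf_neq0 => k _; apply: lam_nz => //; apply: zo. Qed.

Lemma lam_dec n h i z : col_generic n z -> (forall k, (h k < 3)%N) -> (i < n)%N ->
  lam n (dec h i) z = lam n h z * lamr (h i) (x i) z.
Proof.
move=> [z0 zo] h3 ni.
rewrite /lam (prod_dec (g := fun k a => W (x k) z 0 a 0 a)) ?lamrE //; first exact: zo.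
by apply: lam_nz => //; apply: zo.
Qed.

Lemma psiN0 n a h : rows_generic n.+1 -> psi n a h != 0.
Proof.
move=> xo; apply/prodf_neq0 => k _; apply: phi_nz; have [_] := xo n (ltnSn n).
by apply; [exact: leqW|rewrite neq_ltn ltn_ord orbT].
Qed.

Lemma psi_dec n a h i : rows_generic n.+1 -> (i < n)%N ->
  psi n a (dec h i) = psi n a h * (phi a (h i).-1 (x n) (x i) / phi a (h i) (x n) (x i)).
Proof.
move=> xo ni; rewrite /psi (prod_dec (g := fun k b => phi a b (x n) (x k))) //.
apply: phi_nz; have [_] := xo n (ltnSn n).
by apply; [exact: leqW|rewrite neq_ltn ni orbT].
Qed.

Lemma PhiD n h i j : i != j -> (j < n)%N ->
  Phi n h i = phi (h i) (h j) (x i) (x j) *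
   \prod_(k < n | (k != i :> nat) && (k != j :> nat)) phi (h i) (h k) (x i) (x k).
Proof. by move=> ij nj; rewrite /Phi (bigD1 (Ordinal nj)) //= eq_sym. Qed.

(** Lowering i and then j depends on the order only through the factor of the pair (i, j); the rest
    is symmetric ([Phi2C]). *)
Lemma Phi_dec n h i j : i != j -> (i < n)%N -> (j < n)%N ->
  Phi n h i * Phi n (dec h i) j =
  phi (h i) (h j) (x i) (x j) * phi (h j) (h i).-1 (x j) (x i) * Phi2 n h i j.
Proof.
move=> ij ni nj; have ji : j != i by rewrite eq_sym.
rewrite (PhiD h ij nj) (PhiD _ ji ni) decE dec_neq // /Phi2 big_split /=.
rewrite mulrACA; congr (_ * (_ * _)).
under eq_bigl => k do rewrite andbC.
by apply: eq_bigr => k /andP[ki kj]; rewrite dec_neq.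
Qed.

Lemma Phi2C n h i j : Phi2 n h i j = Phi2 n h j i.
Proof. by apply: eq_big => [k|k _]; [rewrite andbC|rewrite mulrC]. Qed.

(** Holds row by row. It reconciles two normalisations: f_{h,0} has component T_0(x n) f_h along 0,
    with eigenvalue [lam n h (x n)], whereas lowering the new row by two should produce the pair
    factors [psi n 2 h * psi n 1 h]. *)
Lemma lam_psi n h : rows_generic n.+1 -> (forall k, (h k < 3)%N) ->
  lam n h (x n) * (psi n 2 h * psi n 1 h) = 1.
Proof.
move=> xo h3; rewrite /lam /psi -big_split -big_split /= big1 // => k _.
have [_ /(_ n (ltnSn n))] := xo k (leqW (ltn_ord k)).
rewrite neq_ltn ltn_ord => /(_ isT) kn; have := indep_sym kn.
move=> /indep_nz[? ? ? ? ?]; case: (indep_nz kn) => ? ? ? ? ?; have o0 := oner_neq0 K.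
case: (h k) (h3 k) => [|[|[|a]]] // _; rewrite /IKweight /phi /=; field;
 repeat (apply/andP; split); done.
Qed.

Lemma rows_generic_last n : rows_generic n.+1 -> col_generic n (x n).
Proof.
move=> xo; have [x0 xn] := xo n (ltnSn n); split=> // i ni.
by apply/indep_sym/xn; [exact: leqW|rewrite neq_ltn ni orbT].
Qed.

Lemma rows_generic_lastq n : rows_generic n.+1 -> col_generic n (x n / q).
Proof.
case: Q => q0 _ _ xo; have [x0 _] := xo n (ltnSn n).
have [_ xn] := rows_generic_last xo.
split=> [|i ni]; first by rewrite mulf_neq0 ?invr_eq0.
by apply: (indep_divq _ (xn i ni)); rewrite mulrC divfK.
Qed.

(** * Components of the column operators along the top row *)

Section Parts.
Variables (n : nat) (z : K) (v : colsp n.+1).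
Local Notation y := (x n).
Ltac pt := rewrite part_col // !big_ord_recl !big_ord0 /IKweight /= !scale0r !addr0 ?add0r
  ?scale1r ?addrA //.
Lemma part00 : part 0 (colop 0 z v) = colop 0 z (part 0 v). Proof. pt. Qed.
Lemma part01 : part 1 (colop 0 z v) =
  W y z 0 1 0 1 *: colop 0 z (part 1 v) + W y z 1 0 0 1 *: colop 1 z (part 0 v).
Proof. pt. Qed.
Lemma part02 : part 2 (colop 0 z v) =
  W y z 0 2 0 2 *: colop 0 z (part 2 v) + W y z 1 1 0 2 *: colop 1 z (part 1 v)
  + W y z 2 0 0 2 *: colop 2 z (part 0 v).
Proof. pt. Qed.
Lemma part10 : part 0 (colop 1 z v) =
  W y z 0 1 1 0 *: colop 0 z (part 1 v) + W y z 1 0 1 0 *: colop 1 z (part 0 v).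
Proof. pt. Qed.
Lemma part11 : part 1 (colop 1 z v) =
  W y z 0 2 1 1 *: colop 0 z (part 2 v) + W y z 1 1 1 1 *: colop 1 z (part 1 v)
  + W y z 2 0 1 1 *: colop 2 z (part 0 v).
Proof. pt. Qed.
Lemma part12 : part 2 (colop 1 z v) =
  W y z 1 2 1 2 *: colop 1 z (part 2 v) + W y z 2 1 1 2 *: colop 2 z (part 1 v).
Proof. pt. Qed.
Lemma part20 : part 0 (colop 2 z v) =
  W y z 0 2 2 0 *: colop 0 z (part 2 v) + W y z 1 1 2 0 *: colop 1 z (part 1 v)
  + W y z 2 0 2 0 *: colop 2 z (part 0 v).
Proof. pt. Qed.
Lemma part21 : part 1 (colop 2 z v) =
  W y z 1 2 2 1 *: colop 1 z (part 2 v) + W y z 2 1 2 1 *: colop 2 z (part 1 v).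
Proof. pt. Qed.
Lemma part22 : part 2 (colop 2 z v) = colop 2 z (part 2 v). Proof. pt. Qed.
End Parts.
Arguments IKweight : simpl never.
Arguments phi : simpl never.
Arguments chi : simpl never.
Arguments colop : simpl never.
Arguments part : simpl never.
Arguments fvec : simpl never.

Lemma partD n l (u v : colsp n.+1) : part l (u + v) = part l u + part l v.
Proof. exact: linearD. Qed.
Lemma partZ n l c (v : colsp n.+1) : part l (c *: v) = c *: part l v.
Proof. exact: linearZ. Qed.
Lemma part_sum n l I (r : seq I) P (F : I -> colsp n.+1) :
  part l (\sum_(i <- r | P i) F i) = \sum_(i <- r | P i) part l (F i).
Proof. exact: linear_sum. Qed.
Lemma colopD n s z (u v : colsp n) : colop s z (u + v) = colop s z u + colop s z v.
Proof. exact: linearD. Qed.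
Lemma colopZ n s z c (v : colsp n) : colop s z (c *: v) = c *: colop s z v.
Proof. exact: linearZ. Qed.
Lemma colop0 n s z : colop s z (0 : colsp n) = 0.
Proof. exact: linear0. Qed.
Lemma colop_sum n s z I (r : seq I) P (F : I -> colsp n) :
  colop s z (\sum_(i <- r | P i) F i) = \sum_(i <- r | P i) colop s z (F i).
Proof. exact: linear_sum. Qed.
Lemma sum_scaler0 n I (r : seq I) P (c : I -> K) :
  \sum_(i <- r | P i) c i *: (0 : colsp n) = 0.
Proof. by apply: big1 => i _; rewrite scaler0. Qed.
Definition simp0 := (@scaler0, @addr0, @add0r, colop0, sum_scaler0, big1_eq).

(** The column is generic with respect to the n rows considered only. When row n is added, the
    formulas may thus be used at z = x n and at z = x n / q. *)
Definition action n := forall h z, (forall k, (h k < 3)%N) -> col_generic n z ->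
 [/\ colop 0 z (fvec n h) = lam n h z *: fvec n h,
     colop 1 z (fvec n h) = \sum_(i < n) tau1 n h i z *: fvec n (dec h i)
   & colop 2 z (fvec n h) =
     \sum_(i < n) tau2 n h i z *: fvec n (dec (dec h i) i)
     + \sum_(i < n) \sum_(j < n | (j < i)%N) tau11 n h i j z *: fvec n (dec (dec h i) j)].

Definition local m T (F : (nat -> nat) -> T) :=
  forall h1 h2, (forall k, (k < m)%N -> h1 k = h2 k) -> F h1 = F h2.

Lemma fcomp_ext m (F : (nat -> nat) -> colsp m) j l :
  local m F -> local m (fcomp F j l).
Proof.
move=> Floc h1 h2 E; have F12 : F h1 = F h2 by apply: Floc.
have psiE a : psi m a h1 = psi m a h2 by apply: eq_bigr => k _; rewrite E.
rewrite /fcomp; case: j => [|[|j]]; case: l => [|[|l]]; rewrite ?F12 ?psiE //.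
apply: eq_bigr => i _; rewrite E //; congr (_ * _ *: _).
  by rewrite /Phi E //; apply: eq_bigr => k _; rewrite E.
by apply: Floc => k km; rewrite /dec E.
Qed.

Lemma fvec_ext m : local m (fvec m).
Proof.
elim: m => // m IHm h1 h2 E; apply: part_inj => l l3.
rewrite [LHS]part_tri // [RHS]part_tri // E //.
by apply: fcomp_ext => // k km; apply: E; apply: leqW.
Qed.

(** * Adding a row of parameter y = x n *)

Section Fix.
Variable n : nat.
Hypotheses (xo : rows_generic n.+1) (IH : action n).
Local Notation y := (x n).
Local Notation w := (y / q).
Local Notation f := (fvec n).
Definition flast (j : nat) (h : nat -> nat) : colsp n.+1 :=
  tri (fun l => fcomp f j l h).
Arguments flast : simpl never.
(** Read off from T_1(w) f_{h,2}: the factor 1/(1 - q) is the ratio of [W y w 1 2 1 2] = -1/q to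
    [W y w 0 2 1 1] = -(1 - q)/q, and the inverse of [psi n 2 h] makes the coefficient of f_{h,1}
    contain the pair factors of the new row. *)
Definition fcoef h i := (psi n 2 h)^-1 * (rho1 (h i) (x i) w / (1 - q)) * Phi n h i.

Lemma part0_flast1 h : part 0 (flast 1 h) = 0. Proof. by []. Qed.
Lemma part1_flast1 h : part 1 (flast 1 h) = (psi n 2 h)^-1 *: f h. Proof. by []. Qed.
Lemma part2_flast1 h : part 2 (flast 1 h) = \sum_(i < n) fcoef h i *: f (dec h i).
Proof. by []. Qed.
Lemma part0_flast2 h : part 0 (flast 2 h) = 0. Proof. by []. Qed.
Lemma part1_flast2 h : part 1 (flast 2 h) = 0. Proof. by []. Qed.
Lemma part2_flast2 h : part 2 (flast 2 h) = f h. Proof. by []. Qed.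
Lemma part_flast0 h l : (l < 3)%N -> part l (flast 0 h) = colop l y (f h).
Proof. by case: l => [|[|[|]]]. Qed.
Definition flastE := (part0_flast1, part1_flast1, part2_flast1, part0_flast2, part1_flast2,
  part2_flast2).

Let psi0 a h : psi n a h != 0 := psiN0 a h xo.
Let q1 : 1 - q != 0. Proof. by case: Q. Qed.
Let yE : y = q * w. Proof. by case: Q => q0 _ _; rewrite mulrC divfK. Qed.
Let xy i : (i < n)%N -> indep (x i) y. Proof. exact: (proj2 (rows_generic_last xo)). Qed.
Let phi20 a b i : (i < n)%N -> phi a b y (x i) != 0.
Proof. by move=> ni; apply/phi_nz/indep_sym/xy. Qed.
Let xx i j : (i < n)%N -> (j < n)%N -> i != j -> indep (x i) (x j).
Proof. by move=> ni nj; apply: (proj2 (xo (leqW ni))); apply: leqW. Qed.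

Lemma psi1E h : (forall k, (h k < 3)%N) -> psi n 1 h = (lam n h y * psi n 2 h)^-1.
Proof.
move=> h3; have := lam_psi xo h3; rewrite mulrA => E.
by apply: (mulfI (_ : lam n h y * psi n 2 h != 0)); rewrite ?divff ?E ?mulf_neq0 //;
  apply: lamN0 => //; apply: rows_generic_last.
Qed.

Lemma fcoef_dec h i j : (i < n)%N -> (j < n)%N -> i != j ->
  Phi n h i * fcoef (dec h i) j =
  (psi n 2 h)^-1 * (phi 2 (h i) y (x i) / phi 2 (h i).-1 y (x i))
  * (rho1 (h j) (x j) w / (1 - q))
  * (phi (h i) (h j) (x i) (x j) * phi (h j) (h i).-1 (x j) (x i)) * Phi2 n h i j.
Proof.
move=> ni nj ij; rewrite /fcoef (psi_dec 2 h xo ni) dec_neq 1?eq_sym //.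
rewrite [LHS](_ : _ = (psi n 2 h)^-1 * (phi 2 (h i) y (x i) / phi 2 (h i).-1 y (x i))
  * (rho1 (h j) (x j) w / (1 - q)) * (Phi n h i * Phi n (dec h i) j)); last first.
  by field; rewrite q1 psi0 !phi20.
by rewrite Phi_dec //; ring.
Qed.

Lemma fcoef_dec_diag h i : (i < n)%N ->
  fcoef (dec h i) i = (psi n 2 h)^-1 * (phi 2 (h i) y (x i) / phi 2 (h i).-1 y (x i))
  * (rho1 (h i).-1 (x i) w / (1 - q)) * Phi n (dec h i) i.
Proof.
move=> ni; rewrite /fcoef (psi_dec 2 h xo ni) decE.
by field; rewrite q1 psi0 !phi20.
Qed.

Lemma tau1_dec h z i j : (forall k, (h k < 3)%N) -> col_generic n z ->
    (i < n)%N -> (j < n)%N -> i != j ->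
  Phi n h i * tau1 n (dec h i) j z =
  lam n h z * lamr (h i) (x i) z * rho1 (h j) (x j) z
  * (phi (h i) (h j) (x i) (x j) * phi (h j) (h i).-1 (x j) (x i)) * Phi2 n h i j.
Proof.
move=> h3 zo ni nj ij; rewrite /tau1 lam_dec // dec_neq 1?eq_sym //.
by rewrite mulrCA Phi_dec //; ring.
Qed.

Lemma tau1_dec_diag h z i : (forall k, (h k < 3)%N) -> col_generic n z -> (i < n)%N ->
  tau1 n (dec h i) i z =
  lam n h z * lamr (h i) (x i) z * rho1 (h i).-1 (x i) z * Phi n (dec h i) i.
Proof. by move=> h3 zo ni; rewrite /tau1 lam_dec // decE. Qed.

(** The coefficient of f_{dec h i, 1} in T_2(z) f_{h,2}, where row i and the new row are both
    lowered by one. That pair contributes [chi], so its [phi] is divided out of [psi]. *)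
Definition kappa h z i := tau1 n h i z *
  (chi (h i) 2 (x i) y z * W y z 0 2 1 1 * (psi n 2 h / phi 2 (h i) y (x i))).

Lemma kappa_fcoef h z i j : (i < n)%N -> (j < n)%N -> i != j ->
  kappa h z i * fcoef (dec h i) j = lam n h z * Phi2 n h i j *
    (rho1 (h i) (x i) z * chi (h i) 2 (x i) y z * W y z 0 2 1 1 / phi 2 (h i).-1 y (x i) *
     (rho1 (h j) (x j) w / (1 - q)) *
     (phi (h i) (h j) (x i) (x j) * phi (h j) (h i).-1 (x j) (x i))).
Proof.
move=> ni nj ij; rewrite /kappa /tau1.
transitivity (lam n h z * rho1 (h i) (x i) z * (chi (h i) 2 (x i) y z * W y z 0 2 1 1 *
   (psi n 2 h / phi 2 (h i) y (x i))) * (Phi n h i * fcoef (dec h i) j)); first by ring.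
by rewrite fcoef_dec //; field; rewrite psi0 q1 !phi20.
Qed.

Lemma kappa_tau1 h z u i j : (forall k, (h k < 3)%N) -> col_generic n u ->
    (i < n)%N -> (j < n)%N -> i != j ->
  kappa h z i * tau1 n (dec h i) j u = lam n h z * lam n h u * psi n 2 h * Phi2 n h i j *
    (rho1 (h i) (x i) z * chi (h i) 2 (x i) y z * W y z 0 2 1 1 / phi 2 (h i) y (x i) *
     lamr (h i) (x i) u * rho1 (h j) (x j) u *
     (phi (h i) (h j) (x i) (x j) * phi (h j) (h i).-1 (x j) (x i))).
Proof.
move=> h3 uo ni nj ij; rewrite /kappa {1}/tau1.
transitivity (lam n h z * rho1 (h i) (x i) z * (chi (h i) 2 (x i) y z * W y z 0 2 1 1 *
   (psi n 2 h / phi 2 (h i) y (x i))) * (Phi n h i * tau1 n (dec h i) j u)); first by ring.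
by rewrite tau1_dec //; field; rewrite !phi20.
Qed.

Section Z.
Variables (h : nat -> nat) (z : K).
Hypotheses (h3 : forall k, (h k < 3)%N) (zo : col_generic n z) (reg : regular y z).

Let xz i : (i < n)%N -> indep (x i) z. Proof. exact: (proj2 zo). Qed.

Lemma colop0_flast2 : colop 0 z (flast 2 h) = (lam n h z * W y z 0 2 0 2) *: flast 2 h.
Proof.
have [A0 _ _] := IH h3 zo.
apply: part_inj => -[|[|[|//]]] _; rewrite partZ.
- by rewrite part00 !flastE !simp0.
- by rewrite part01 !flastE !simp0.
- by rewrite part02 !flastE !simp0 A0 scalerA mulrC.
Qed.

Lemma colop1_flast2 : colop 1 z (flast 2 h) =
  (lam n h z * psi n 2 h * W y z 0 2 1 1) *: flast 1 h
  + \sum_(i < n) (tau1 n h i z * phi (h i) 2 (x i) y * W y z 0 2 0 2) *: flast 2 (dec h i).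
Proof.
have [A0 A1 _] := IH h3 zo.
apply: part_inj => -[|[|[|//]]] _; rewrite partD partZ part_sum;
  under eq_bigr => i _ do rewrite partZ flastE.
- by rewrite part10 !flastE !simp0.
- rewrite part11 !flastE !simp0 A0 !scalerA; congr (_ *: _); field.
  by rewrite psi0.
- rewrite part12 !flastE !simp0 A1 !scaler_sumr sumrD.
  apply: eq_bigr => i _ /=; rewrite !scalerA -scalerDl; congr (_ *: _).
  have E := coef_T1_two_single yE reg (xy (ltn_ord i)) (xz (ltn_ord i)) (h3 i).
  rewrite /tau1 /fcoef.
  transitivity (lam n h z * Phi n h i * (W y z 1 2 1 2 * rho1 (h i) (x i) z)); first by ring.
  by rewrite E; field; rewrite psi0 q1.
Qed.

Lemma colop0_flast1 : colop 0 z (flast 1 h) = (lam n h z * W y z 0 1 0 1) *: flast 1 h.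
Proof.
have [A0 A1 _] := IH h3 zo.
apply: part_inj => -[|[|[|//]]] _; rewrite partZ.
- by rewrite part00 !flastE !simp0.
- by rewrite part01 !flastE !simp0 colopZ A0 !scalerA; congr (_ *: _); ring.
- rewrite part02 !flastE !simp0 colop_sum colopZ A1 !scaler_sumr sumrD.
  apply: eq_bigr => i _ /=; rewrite colopZ.
  have [-> _ _] := IH (dec_lt3 i h3) zo.
  rewrite !scalerA -scalerDl; congr (_ *: _).
  have E := coef_T0_one_single yE reg (xy (ltn_ord i)) (xz (ltn_ord i)) (h3 i).
  rewrite /tau1 /fcoef lam_dec //.
  transitivity (lam n h z * Phi n h i / psi n 2 h *
    (W y z 0 1 0 1 * (rho1 (h i) (x i) w / (1 - q)))); first by rewrite -E; field;
      rewrite q1 psi0.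
  by field; rewrite q1 psi0.
Qed.

(** Component 0 along the new row is settled by [lam_psi], component 1 lowers one old row by one,
    and component 2 lowers the old rows by two in total, which splits into the double and pair
    identities. *)
Lemma colop2_flast2 : colop 2 z (flast 2 h) =
  (lam n h z * (psi n 2 h * psi n 1 h) * W y z 0 2 2 0) *: flast 0 h
  + \sum_(i < n) kappa h z i *: flast 1 (dec h i)
  + (\sum_(i < n) (tau2 n h i z * (phi 2 2 (x i) y * phi 1 2 (x i) y) * W y z 0 2 0 2)
        *: flast 2 (dec (dec h i) i)
     + \sum_(i < n) \sum_(j < n | (j < i)%N)
         (tau11 n h i j z * (phi (h i) 2 (x i) y * phi (h j) 2 (x j) y) * W y z 0 2 0 2)
           *: flast 2 (dec (dec h i) j)).
Proof.
have [A0 A1 A2] := IH h3 zo; have [B0 B1 B2] := IH h3 (rows_generic_last xo).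
have p1 := psi1E h3; have lamy0 := lamN0 (rows_generic_last xo) h3.
apply: part_inj => -[|[|[|//]]] _; rewrite !partD !part_sum partZ part_flast0 //;
  under [X in _ + X + _]eq_bigr => i _ do rewrite partZ flastE;
  under [X in _ + (X + _)]eq_bigr => i _ do rewrite partZ flastE;
  under [X in _ + (_ + X)]eq_bigr => i _ do
    (rewrite part_sum; under eq_bigr => j _ do rewrite partZ flastE).
- rewrite part20 !flastE !simp0 B0 A0 scalerA.
  under eq_bigr => i _ do rewrite !simp0.
  rewrite !simp0 scalerA; congr (_ *: _).
  by rewrite p1; field; rewrite psi0 lamy0.
- rewrite part21 !flastE !simp0.
  under [X in _ = _ + X]eq_bigr => i _ do rewrite !simp0.
  rewrite !simp0 A1 B1 !scaler_sumr sumrD /=; apply: eq_bigr => i _.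
  have ni := ltn_ord i.
  rewrite !scalerA -scalerDl; congr (_ *: _).
  have E := coef_T2_two_single yE reg (xy ni) (xz ni) (h3 i).
  rewrite /kappa /tau1 (psi_dec 2 h xo ni).
  transitivity (lam n h z * Phi n h i * (W y z 1 2 2 1 * rho1 (h i) (x i) z)); first by ring.
  by rewrite E p1; field; rewrite psi0 lamy0 !phi20.
- rewrite part22 !flastE A2 B2.
  under [X in _ = _ + X + _]eq_bigr => i _ do
    (rewrite scaler_sumr; under eq_bigr => j _ do rewrite scalerA).
  rewrite (sum_sym_split n (fun i j =>
    (kappa h z i * fcoef (dec h i) j) *: f (dec (dec h i) j))).
  rewrite scalerDr addr6 !scaler_sumr.
  congr (_ + _); rewrite !sumrD /=; apply: eq_bigr => i _; have ni := ltn_ord i.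
    rewrite !scalerA -!scalerDl; congr (_ *: _).
    rewrite /kappa fcoef_dec_diag // /tau2 /tau1.
    have E := coef_T2_two_double yE reg (xy ni) (xz ni).
    (* A row in state 0 or 1 cannot be lowered twice: every term then contains a vanishing [rho1] or
       [rho2]. *)
    have := h3 i; case hi: (h i) => [|[|[|//]]] _.
    - by rewrite /rho1 /rho2 /=; ring.
    - by rewrite /rho1 /rho2 /=; ring.
    rewrite [in LHS]E p1 -[2.-1]/1%N.
    by field; rewrite psi0 q1 lamy0 !phi20.
  rewrite scaler_sumr !sumrD /=; apply: eq_bigr => j ji.
  have nj := ltn_ord j; have nij : i != j :> nat by rewrite neq_ltn ji orbT.
  rewrite (decC h j) !scalerA -!scalerDl; congr (_ *: _).
  have E := coef_T2_two_pair yE reg (xx ni nj nij) (xy ni) (xy nj) (xz ni) (xz nj) (h3 i) (h3 j).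
  have nji : j != i :> nat by rewrite eq_sym.
  rewrite (kappa_fcoef _ _ ni nj nij) (kappa_fcoef _ _ nj ni nji) (@Phi2C _ _ j i) /tau11.
  rewrite [in LHS]E p1.
  by field; rewrite psi0 lamy0 q1 !phi20.
Qed.

Lemma fcoef_tau1 i j : (i < n)%N -> (j < n)%N -> i != j ->
  fcoef h i * tau1 n (dec h i) j z = lam n h z * (psi n 2 h)^-1 * Phi2 n h i j *
    (rho1 (h i) (x i) w / (1 - q) * lamr (h i) (x i) z * rho1 (h j) (x j) z *
    (phi (h i) (h j) (x i) (x j) * phi (h j) (h i).-1 (x j) (x i))).
Proof.
move=> ni nj ij; rewrite {1}/fcoef.
transitivity ((psi n 2 h)^-1 * (rho1 (h i) (x i) w / (1 - q)) *
   (Phi n h i * tau1 n (dec h i) j z)); first by ring.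
by rewrite tau1_dec //; ring.
Qed.

Lemma tau1_fcoef i j : (i < n)%N -> (j < n)%N -> i != j ->
  tau1 n h i z * fcoef (dec h i) j = lam n h z * (psi n 2 h)^-1 * Phi2 n h i j *
    (rho1 (h i) (x i) z * (phi 2 (h i) y (x i) / phi 2 (h i).-1 y (x i))
     * (rho1 (h j) (x j) w / (1 - q)) *
    (phi (h i) (h j) (x i) (x j) * phi (h j) (h i).-1 (x j) (x i))).
Proof.
move=> ni nj ij; rewrite {1}/tau1.
transitivity (lam n h z * rho1 (h i) (x i) z * (Phi n h i * fcoef (dec h i) j)); first by ring.
by rewrite fcoef_dec //; ring.
Qed.

Lemma colop1_flast1 : colop 1 z (flast 1 h) =
  (lam n h z * psi n 1 h * W y z 0 1 1 0) *: flast 0 h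
  + \sum_(i < n) (tau1 n h i z * phi (h i) 1 (x i) y * W y z 0 1 0 1) *: flast 1 (dec h i).
Proof.
have [A0 A1 A2] := IH h3 zo; have [B0 B1 B2] := IH h3 (rows_generic_last xo).
have p1 := psi1E h3; have lamy0 := lamN0 (rows_generic_last xo) h3.
apply: part_inj => -[|[|[|//]]] _; rewrite partD part_sum partZ part_flast0 //;
  under [X in _ + X]eq_bigr => i _ do rewrite partZ flastE.
- rewrite part10 !flastE !simp0 colopZ A0 B0 !scalerA; congr (_ *: _).
  by rewrite p1; field; rewrite psi0 lamy0.
- rewrite part11 !flastE !simp0 colopZ colop_sum A1 B1 !scaler_sumr !sumrD.
  apply: eq_bigr => i _; have ni := ltn_ord i.
  rewrite colopZ; have [-> _ _] := IH (dec_lt3 i h3) zo.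
  rewrite !scalerA -!scalerDl; congr (_ *: _).
  have E := coef_T1_one_single yE reg (xy ni) (xz ni) (h3 i).
  rewrite /fcoef /tau1 lam_dec // (psi_dec 2 h xo ni) p1.
  transitivity (lam n h z * Phi n h i / psi n 2 h *
    (W y z 1 1 1 1 * rho1 (h i) (x i) z + W y z 0 2 1 1 * (rho1 (h i) (x i) w / (1 - q)) *
      lamr (h i) (x i) z)).
    by field; rewrite psi0 q1.
  by rewrite E; field; rewrite psi0 lamy0 !phi20.
- rewrite part12 !flastE colopZ colop_sum A2 B2.
  under [X in _ *: X + _]eq_bigr => i _.
    rewrite colopZ; have [_ -> _] := IH (dec_lt3 i h3) zo.
    rewrite scaler_sumr; under eq_bigr => j _ do rewrite scalerA.
    over.
  under [X in _ = _ + X]eq_bigr => i _ do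
    (rewrite scaler_sumr; under eq_bigr => j _ do rewrite scalerA).
  rewrite (sum_sym_split n (fun i j =>
    (fcoef h i * tau1 n (dec h i) j z) *: f (dec (dec h i) j))).
  rewrite (sum_sym_split n (fun i j => (tau1 n h i z * phi (h i) 1 (x i) y * W y z 0 1 0 1 *
    fcoef (dec h i) j) *: f (dec (dec h i) j))).
  rewrite !scalerDr [LHS]addrACA [RHS]addrACA !scaler_sumr.
  congr (_ + _); rewrite !sumrD /=; apply: eq_bigr => i _; have ni := ltn_ord i.
    rewrite !scalerA -!scalerDl; congr (_ *: _).
    rewrite fcoef_dec_diag // tau1_dec_diag // /fcoef /tau1 /tau2 p1.
    have E := coef_T1_one_double yE reg (xy ni) (xz ni).
    have := h3 i; case hi: (h i) => [|[|[|//]]] _.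
    - by rewrite /rho1 /rho2 /=; ring.
    - by rewrite /rho1 /rho2 /=; ring.
    rewrite -[2.-1]/1%N.
    transitivity (lam n h z * (Phi n h i * Phi n (dec h i) i) / psi n 2 h *
     (W y z 1 2 1 2 * (rho1 2 (x i) w / (1 - q)) * lamr 2 (x i) z * rho1 1 (x i) z +
      W y z 2 1 1 2 * rho2 2 (x i) z)); first by field; rewrite psi0 q1.
    by rewrite E; field; rewrite psi0 q1 lamy0 !phi20.
  rewrite !scaler_sumr !sumrD /=; apply: eq_bigr => j ji.
  have nj := ltn_ord j; have nij : i != j :> nat by rewrite neq_ltn ji orbT.
  have nji : j != i :> nat by rewrite eq_sym.
  rewrite (decC h j) !scalerA -!scalerDl !scalerA -!scalerDl; congr (_ *: _).
  have E := coef_T1_one_pair yE reg (xx ni nj nij) (xy ni) (xy nj) (xz ni) (xz nj) (h3 i) (h3 j).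
  apply: (etrans _ (etrans (congr1 ( *%R (lam n h z * Phi2 n h i j / psi n 2 h)) E) _)).
    rewrite (fcoef_tau1 ni nj nij) (fcoef_tau1 nj ni nji) (@Phi2C _ _ j i) /tau11.
    by field; rewrite psi0 q1.
  transitivity (lam n h z * psi n 1 h * W y z 0 1 1 0 * tau11 n h i j y +
    (phi (h i) 1 (x i) y * W y z 0 1 0 1 * (tau1 n h i z * fcoef (dec h i) j) +
     phi (h j) 1 (x j) y * W y z 0 1 0 1 * (tau1 n h j z * fcoef (dec h j) i))); last by ring.
  rewrite (tau1_fcoef ni nj nij) (tau1_fcoef nj ni nji) (@Phi2C _ _ j i) /tau11 p1.
  by field; rewrite psi0 q1 lamy0 !phi20.
Qed.

End Z.

Lemma IKden_nz u v : indep u v -> IKden q u v != 0.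
Proof. by case/indep_nz => _ _ *; rewrite mulf_neq0. Qed.

Section Last0.
Variables (h : nat -> nat) (z : K).
Hypotheses (h3 : forall k, (h k < 3)%N) (zo : col_generic n z) (reg : regular y z).

(** The weights of the new row at column z are exactly the exchange weights of the columns y and z,
    so the exchange relation moves T_s(z) inside: on f_{h,0} it acts as on f_h, the new row being a
    spectator. *)
Lemma colop_flast0 s : (s < 3)%N ->
  colop s z (flast 0 h) = tri (fun l => colop l y (colop s z (f h))).
Proof.
move=> s3; apply: part_inj => l l3; rewrite part_col // part_tri //.
rewrite -(@colop_RTT n y z (f h) s l) //.
- rewrite exchange_big; apply: eq_bigr => a _; apply: eq_bigr => b _.
  by rewrite part_flast0.
- by move=> i ni; apply/IKden_nz/xy.
- by move=> i ni; apply/IKden_nz/(proj2 zo).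
- by case: reg => *; apply: mulf_neq0.
Qed.

Lemma tri_lin I (r : seq I) P (c : I -> K) (F : I -> nat -> nat) :
  \sum_(i <- r | P i) c i *: flast 0 (F i)
  = tri (fun l => colop l y (\sum_(i <- r | P i) c i *: f (F i))).
Proof.
apply: part_inj => l l3; rewrite part_sum part_tri // colop_sum.
by apply: eq_bigr => i _; rewrite partZ part_flast0 // colopZ.
Qed.

Lemma colop0_flast0 : colop 0 z (flast 0 h) = lam n h z *: flast 0 h.
Proof.
rewrite colop_flast0 //; have [-> _ _] := IH h3 zo; apply: part_inj => l l3.
by rewrite part_tri // partZ part_flast0 // colopZ.
Qed.

Lemma colop1_flast0 : colop 1 z (flast 0 h) = \sum_(i < n) tau1 n h i z *: flast 0 (dec h i).
Proof. by rewrite colop_flast0 //; have [_ -> _] := IH h3 zo; rewrite tri_lin. Qed.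

Lemma colop2_flast0 : colop 2 z (flast 0 h) =
  \sum_(i < n) tau2 n h i z *: flast 0 (dec (dec h i) i)
  + \sum_(i < n) \sum_(j < n | (j < i)%N) tau11 n h i j z *: flast 0 (dec (dec h i) j).
Proof.
rewrite colop_flast0 //; have [_ _ ->] := IH h3 zo.
apply: part_inj => l l3; rewrite part_tri // partD colopD; congr (_ + _).
  by rewrite tri_lin part_tri.
rewrite part_sum colop_sum; apply: eq_bigr => i _.
by rewrite tri_lin part_tri.
Qed.
End Last0.

(** The contribution to T_1(u) T_2(z) f_{h,2} in which T_2(z) lowers row i together with the new row
    and T_1(u) then lowers row j. *)
Definition kappa1 h z u i j := kappa h z i *
  (tau1 n (dec h i) j u * phi (dec h i j) 1 (x j) y * W y u 0 1 0 1).

Lemma kappa1E h z u i j : (forall k, (h k < 3)%N) -> col_generic n u ->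
    (i < n)%N -> (j < n)%N -> i != j ->
  kappa1 h z u i j = lam n h z * lam n h u * psi n 2 h * Phi2 n h i j *
    (rho1 (h i) (x i) z * chi (h i) 2 (x i) y z * W y z 0 2 1 1 / phi 2 (h i) y (x i) *
     lamr (h i) (x i) u * rho1 (h j) (x j) u *
     (phi (h i) (h j) (x i) (x j) * phi (h j) (h i).-1 (x j) (x i))) *
    (phi (h j) 1 (x j) y * W y u 0 1 0 1).
Proof.
move=> h3 uo ni nj ij; rewrite -kappa_tau1 // /kappa1 dec_neq 1?eq_sym //.
by move: (kappa h z i) (tau1 n (dec h i) j u) (phi _ _ _ _) (W y u 0 1 0 1) => a b c d; ring.
Qed.

Lemma colop1_kappa h z u : (forall k, (h k < 3)%N) -> col_generic n u -> regular y u ->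
  colop 1 u (\sum_(i < n) kappa h z i *: flast 1 (dec h i)) =
  \sum_(i < n) (kappa h z i * (lam n (dec h i) u * psi n 1 (dec h i) * W y u 0 1 1 0))
     *: flast 0 (dec h i)
  + (\sum_(i < n) kappa1 h z u i i *: flast 1 (dec (dec h i) i)
    + \sum_(i < n) \sum_(j < n | (j < i)%N)
       (kappa1 h z u i j + kappa1 h z u j i) *: flast 1 (dec (dec h i) j)).
Proof.
move=> h3 uo reg.
rewrite [X in _ + (_ + X)](_ : _ = \sum_(i < n) \sum_(j < n | (j < i)%N)
   (kappa1 h z u i j *: flast 1 (dec (dec h i) j) +
     kappa1 h z u j i *: flast 1 (dec (dec h j) i))); last first.
  by apply: eq_bigr => i _; apply: eq_bigr => j _; rewrite (decC h j) scalerDl.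
rewrite -(sum_sym_split n (fun i j => kappa1 h z u i j *: flast 1 (dec (dec h i) j))).
rewrite colop_sum sumrD; apply: eq_bigr => i _.
rewrite colopZ colop1_flast1 //; last exact: dec_lt3.
rewrite scalerDr scaler_sumr scalerA; congr (_ + _).
by apply: eq_bigr => j _; rewrite scalerA.
Qed.

Lemma regular_w : regular y w.
Proof.
case: Q => q0 q1' q2; have [y0 _] := xo (ltnSn n).
have E k : y - q ^+ k.+1 * w = y * (1 - q ^+ k) by rewrite exprS; field.
by split; rewrite ?E ?mulf_neq0 ?invr_eq0.
Qed.

Lemma W0202w : W y w 0 2 0 2 = 0.
Proof. by case: Q => q0 _ _; rewrite /IKweight [q * w]mulrC divfK // subrr mulr0 mul0r. Qed.

Section Last1.
Variables (h : nat -> nat) (z : K).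
Hypotheses (h3 : forall k, (h k < 3)%N) (zo : col_generic n z) (yz : indep y z).

Let reg : regular y z.
Proof.
have [y0 _] := xo (ltnSn n); have [z0 _] := zo.
by split=> //; case: (indep_nz yz).
Qed.

Let q0 : q != 0. Proof. by case: Q. Qed.

Let xz i : (i < n)%N -> indep (x i) z. Proof. exact: (proj2 zo). Qed.

(** Conservation leaves two terms in the exchange relation with top state 2 and right state 1; it is
    solved here for T_2(z) T_1(w). *)
Lemma RTT21 (v : colsp n.+1) :
  W w z 2 1 2 1 *: colop 2 z (colop 1 w v) =
  colop 1 w (colop 2 z v) - W w z 1 2 2 1 *: colop 1 z (colop 2 w v).
Proof.
have R := @colop_RTT n.+1 w z v 2 1.
rewrite -R //.
- by rewrite !big_ord_recl !big_ord0 /= /IKweight /= !scale0r !simp0 addrK.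
- move=> i; rewrite ltnS leq_eqVlt => /orP[/eqP->|ni].
    by case: regular_w => *; apply: mulf_neq0.
  by apply/IKden_nz/(proj2 (rows_generic_lastq xo)).
- move=> i; rewrite ltnS leq_eqVlt => /orP[/eqP->|ni]; last by apply/IKden_nz/xz.
  by case: reg => *; apply: mulf_neq0.
- have E k : w - q ^+ k * z = (y - q ^+ k.+1 * z) / q by rewrite exprS; field.
  by rewrite /IKden !E !mulf_neq0 ?invr_eq0 ?indepl.
Qed.

(** Comparing components would lower three old rows at once. Instead f_{h,1} is replaced by the
    proportional vector T_1(w) f_{h,2} and [RTT21] is applied, after which only actions already
    computed occur. *)
Lemma colop2_flast1 : colop 2 z (flast 1 h) =
  \sum_(i < n) (tau1 n h i z * (chi (h i) 1 (x i) y z * W y z 0 1 1 0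
      * (psi n 1 h / phi 1 (h i) y (x i)))) *: flast 0 (dec h i)
  + (\sum_(i < n) (tau2 n h i z * (phi 2 1 (x i) y * phi 1 1 (x i) y) * W y z 0 1 0 1)
        *: flast 1 (dec (dec h i) i)
     + \sum_(i < n) \sum_(j < n | (j < i)%N)
         (tau11 n h i j z * (phi (h i) 1 (x i) y * phi (h j) 1 (x j) y) * W y z 0 1 0 1)
           *: flast 1 (dec (dec h i) j)).
Proof.
have wo := rows_generic_lastq xo; have yo := rows_generic_last xo; have rw := regular_w.
have xw i : (i < n)%N -> indep (x i) w by apply: (proj2 wo).
(* The exchange weight times the factor relating T_1(w) f_{h,2} to f_{h,1}. The former contains y -
   q z, which is why [indep y z] is assumed here instead of [regular y z]. *)
have Cnz : W w z 2 1 2 1 * (lam n h w * psi n 2 h * W y w 0 2 1 1) != 0.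
  case: Q => _ q1' q2; have [y0 z0 yz2 yz3] := reg; have [_ _ yw2 yw3] := rw.
  have yzq := indepl 1 yz; rewrite expr1 in yzq.
  have -> : W y w 0 2 1 1 = - (1 - q) / q.
    rewrite /IKweight; field; rewrite q0 /=.
    have -> : y - q ^+ 2 * y = y * (1 - q ^+ 2) by ring.
    have -> : y - q * y = y * (1 - q) by ring.
    by rewrite !mulf_neq0.
  have -> : W w z 2 1 2 1 = q ^+ 2 * (y - q * z) / (y - q ^+ 3 * z).
    by rewrite /IKweight; field; rewrite q0 yz3.
  by rewrite !mulf_neq0 ?invr_eq0 ?expf_neq0 ?oppr_eq0 //; apply: lamN0.
apply: (scalerI Cnz).
have E1 : colop 1 w (flast 2 h) = (lam n h w * psi n 2 h * W y w 0 2 1 1) *: flast 1 h.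
  rewrite colop1_flast2 // W0202w big1 ?addr0 // => i _.
  by rewrite mulr0 scale0r.
have E2 : colop 2 w (flast 2 h) = (lam n h w * (psi n 2 h * psi n 1 h)
      * W y w 0 2 2 0) *: flast 0 h
  + \sum_(i < n) kappa h w i *: flast 1 (dec h i).
  rewrite colop2_flast2 // W0202w -[RHS]addr0; congr (_ + _).
  rewrite big1 ?add0r => [|i _]; last by rewrite mulr0 scale0r.
  by rewrite big1 // => i _; rewrite big1 // => j _; rewrite mulr0 scale0r.
rewrite -scalerA -colopZ -E1 RTT21 E2 colop2_flast2 //.
rewrite !colopD !colopZ !colop1_kappa // !colop1_flast0 //.
rewrite !colop_sum.
(* On the terms of T_2(z) f_{h,2} along vectors f_{h',2}, T_1(w) leaves only multiples of f_{h',1},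
   because [W y w 0 2 0 2] vanishes. *)
under [X in _ + (X + _) - _]eq_bigr => i _.
  rewrite colopZ colop1_flast2 //; last by do 2 apply: dec_lt3.
  rewrite W0202w [X in _ + X]big1 ?addr0; last by move=> ? _; rewrite mulr0 scale0r.
  rewrite scalerA; over.
under [X in _ + (_ + X) - _]eq_bigr => i _.
  rewrite colop_sum; under eq_bigr => j _.
    rewrite colopZ colop1_flast2 //; last by do 2 apply: dec_lt3.
    rewrite W0202w [X in _ + X]big1 ?addr0; last by move=> ? _; rewrite mulr0 scale0r.
    rewrite scalerA; over.
  over.
rewrite -scaleNr !scalerDr addr10 !scaler_sumr.
congr (_ + (_ + _)); rewrite !sumrD; apply: eq_bigr => i _; have ni := ltn_ord i.
- rewrite !scalerA -!scalerDl; congr (_ *: _).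
  rewrite /kappa /tau1 !lam_dec // !(psi_dec 1 h xo ni).
  apply: (etrans _ (etrans (congr1 ( *%R (lam n h z * lam n h w * psi n 2 h * psi n 1 h *
    Phi n h i))
     (coef_T2_one_single yE reg (xy ni) (xz ni) (h3 i))) _)); last by field; rewrite !phi20.
  by field; rewrite !phi20.
- rewrite !scalerA -!scalerDl; congr (_ *: _).
  rewrite /kappa1 !tau1_dec_diag // !lam_dec ?decE //; try exact: dec_lt3.
  rewrite (psi_dec 2 (dec h i) xo ni) (psi_dec 2 h xo ni) decE /kappa /tau1 /tau2.
  have E := coef_T2_one_double yE reg (xy ni) (xz ni).
  have := h3 i; case hi: (h i) => [|[|[|//]]] _.
  - by rewrite /rho1 /rho2 /=; ring.
  - by rewrite /rho1 /rho2 /=; ring.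
  rewrite -[2.-1]/1%N -[1.-1]/0%N (_ : phi 2 0 y (x i) = 1) //.
  apply: (etrans _ (etrans (congr1 ( *%R (lam n h z * lam n h w * psi n 2 h *
     (Phi n h i * Phi n (dec h i) i))) E) _)); last by ring.
  by field; rewrite !phi20.
- rewrite scaler_sumr !scaler_sumr !sumrD; apply: eq_bigr => j ji.
  have nj := ltn_ord j; have nij : i != j :> nat by rewrite neq_ltn ji orbT.
  have nji : j != i :> nat by rewrite eq_sym.
  rewrite !scalerA -!scalerDl; congr (_ *: _).
  rewrite (lam_dec wo (dec_lt3 i h3) nj) (lam_dec wo h3 ni) (psi_dec 2 (dec h i) xo nj).
  rewrite (psi_dec 2 h xo ni) !kappa1E // (@Phi2C _ _ j i) !(dec_neq _ nji) /tau11.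
  apply: (etrans _ (etrans (congr1 ( *%R (lam n h z * lam n h w * psi n 2 h * Phi2 n h i j))
    (coef_T2_one_pair yE reg (xx ni nj nij) (xy ni) (xy nj) (xz ni) (xz nj) (h3 i) (h3 j))) _));
      last by ring.
  by field; rewrite !phi20.
Qed.
End Last1.

(** * Assembling the action on n + 1 rows *)

Section Assemble.
Variables (h : nat -> nat) (z : K).
Hypotheses (h3 : forall k, (h k < 3)%N) (zo : col_generic n.+1 z).

Let zo' : col_generic n z := col_genericS zo.
Let yz : indep y z. Proof. by apply: (proj2 zo). Qed.

Lemma fvecS h' : fvec n.+1 h' = flast (h' n) h'. Proof. by []. Qed.

Lemma flast_dec h' j : flast j (dec h' n) = flast j h'.
Proof.
apply: part_inj => l l3; rewrite !part_tri //.
apply: fcomp_ext => [? ? E|k kn]; first exact: fvec_ext.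
by rewrite dec_neq // neq_ltn kn.
Qed.

Lemma fvec_decl i : (i < n)%N -> fvec n.+1 (dec h i) = flast (h n) (dec h i).
Proof. by move=> ni; rewrite fvecS dec_neq // neq_ltn ni orbT. Qed.
Lemma fvec_decn : fvec n.+1 (dec h n) = flast (h n).-1 h.
Proof. by rewrite fvecS decE flast_dec. Qed.

Lemma W0000 u v : W u v 0 0 0 0 = 1. Proof. by []. Qed.
Lemma phi_0 a u v : phi a 0 u v = 1. Proof. by case: a => [|[|a]]. Qed.

Lemma lamS : lam n.+1 h z = lam n h z * W y z 0 (h n) 0 (h n).
Proof. by rewrite /lam big_ord_recr. Qed.
Lemma PhiS h' i : (i < n)%N -> Phi n.+1 h' i = Phi n h' i * phi (h' i) (h' n) (x i) y.
Proof.
move=> ni; rewrite /Phi big_mkcond big_ord_recr /= -big_mkcond.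
by rewrite neq_ltn ni orbT.
Qed.

Lemma Phi_last h' : Phi n.+1 h' n = psi n (h' n) h'.
Proof.
rewrite /Phi big_mkcond big_ord_recr /= eqxx mulr1; apply: eq_bigr => k _.
by rewrite neq_ltn ltn_ord.
Qed.

Lemma Phi2S i j : (i < n)%N -> (j < n)%N ->
  Phi2 n.+1 h i j = Phi2 n h i j * (phi (h i) (h n) (x i) y * phi (h j) (h n) (x j) y).
Proof.
move=> ni nj; rewrite /Phi2 big_mkcond big_ord_recr /= -big_mkcond.
by rewrite !neq_ltn ni nj !orbT.
Qed.

Lemma Phi2_last j : (j < n)%N ->
  Phi2 n.+1 h n j = Phi n h j * (psi n (h n) h / phi (h n) (h j) y (x j)).
Proof.
move=> nj; rewrite /Phi2 big_mkcond big_ord_recr /= -big_mkcond eqxx /= mulr1.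
have -> : psi n (h n) h = \prod_(k < n | k != j :> nat) phi (h n) (h k) y (x k) *
  phi (h n) (h j) y (x j).
  by rewrite /psi (bigD1 (Ordinal nj)) //= mulrC.
rewrite mulfK ?phi20 // mulrC /Phi -big_split /=.
by apply: eq_bigl => k; rewrite neq_ltn ltn_ord.
Qed.

Lemma chiC a b u v t : chi a b u v t = chi b a v u t.
Proof.
rewrite /chi; case: a => [|[|a]]; case: b => [|[|b]] //;
  by [congr (- (_ / _)); ring | congr (_ / _); ring].
Qed.

(** Turns the amplitude of the new row back into a plain weight, the form in which the coefficients
    on f_{h,1} and f_{h,2} were computed. *)
Lemma last_rho1 a : W y z 0 a 0 a * rho1 a y z =
  match a with 1 => W y z 0 1 1 0 | 2 => W y z 0 2 1 1 | _ => 0 end.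
Proof.
case: (indep_nz yz) => ? ? ? ? _.
case: a => [|[|[|a]]]; rewrite /rho1 /IKweight ?mulr0 ?mul0r //; field;
  exact/and4P || exact/and3P || exact/andP.
Qed.

Lemma last_rho2 a : W y z 0 a 0 a * rho2 a y z = if a == 2%N then W y z 0 2 2 0 else 0.
Proof.
case: (indep_nz yz) => ? ? ? ? _.
case: a => [|[|[|a]]]; rewrite /rho2 /IKweight ?mulr0 ?mul0r //; field;
  exact/and4P || exact/and3P || exact/andP.
Qed.

Lemma reg_z : regular y z.
Proof. by case: (indep_nz yz) => *; split=> //; [case: (xo (ltnSn n))|case: zo]. Qed.

Lemma action_step0 : colop 0 z (fvec n.+1 h) = lam n.+1 h z *: fvec n.+1 h.
Proof.
have reg := reg_z; rewrite lamS fvecS; case: (h n) (h3 n) => [|[|[|//]]] _.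
- by rewrite colop0_flast0 // W0000 mulr1.
- by rewrite colop0_flast1.
- by rewrite colop0_flast2.
Qed.

Lemma action_step1 : colop 1 z (fvec n.+1 h) =
   \sum_(i < n.+1) tau1 n.+1 h i z *: fvec n.+1 (dec h i).
Proof.
have reg := reg_z.
rewrite big_ord_recr /= {2}/tau1 Phi_last lamS fvec_decn.
under eq_bigr => i _ do rewrite fvec_decl // /tau1 lamS PhiS //.
rewrite -[lam n h z * _ * rho1 _ _ _]mulrA last_rho1 fvecS; case: (h n) (h3 n) => [|[|[|//]]] _.
- rewrite colop1_flast0 // mulr0 mul0r scale0r addr0; apply: eq_bigr => i _.
  by rewrite W0000 !phi_0 !mulr1.
- rewrite colop1_flast1 // addrC; congr (_ + _); first by congr (_ *: _); ring.
  by apply: eq_bigr => i _; congr (_ *: _); rewrite /tau1; ring.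
- rewrite colop1_flast2 // addrC; congr (_ + _); first by congr (_ *: _); ring.
  by apply: eq_bigr => i _; congr (_ *: _); rewrite /tau1; ring.
Qed.

Lemma tau2S i : (i < n)%N -> tau2 n.+1 h i z =
  tau2 n h i z * (phi 2 (h n) (x i) y * phi 1 (h n) (x i) y) * W y z 0 (h n) 0 (h n).
Proof.
move=> ni; rewrite /tau2 lamS !PhiS // decE dec_neq; last by rewrite neq_ltn ni orbT.
(* The states 2 and 1 in the new pair factors are correct only for h i = 2; otherwise [rho2] makes
   both sides vanish. *)
by case: (h i) (h3 i) => [|[|[|//]]] _; rewrite /rho2 -?[2.-1]/1%N; ring.
Qed.

Lemma tau2_last : tau2 n.+1 h n z =
  if h n == 2%N then lam n h z * (psi n 2 h * psi n 1 h) * W y z 0 2 2 0 else 0.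
Proof.
rewrite /tau2 lamS !Phi_last -[lam n h z * _ * _]mulrA last_rho2 decE.
case: eqP => [->|_]; last by rewrite mulr0 mul0r.
have -> : psi n 2.-1 (dec h n) = psi n 1 h.
  by apply: eq_bigr => k _; rewrite dec_neq // neq_ltn ltn_ord.
by ring.
Qed.

Lemma tau11S i j : (i < n)%N -> (j < n)%N -> tau11 n.+1 h i j z =
  tau11 n h i j z * (phi (h i) (h n) (x i) y * phi (h j) (h n) (x j) y) * W y z 0 (h n) 0 (h n).
Proof. by move=> ni nj; rewrite /tau11 lamS Phi2S //; ring. Qed.
Lemma tau11_last j : (j < n)%N -> tau11 n.+1 h n j z =
  tau1 n h j z * (chi (h j) (h n) (x j) y z *
    (W y z 0 (h n) 0 (h n) * rho1 (h n) y z) * (psi n (h n) h / phi (h n) (h j) y (x j))).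
Proof.
by move=> nj; rewrite /tau11 /tau1 lamS Phi2_last // /rho11 chiC; ring.
Qed.

Lemma action_step2 : colop 2 z (fvec n.+1 h) =
  \sum_(i < n.+1) tau2 n.+1 h i z *: fvec n.+1 (dec (dec h i) i)
  + \sum_(i < n.+1) \sum_(j < n.+1 | (j < i)%N)
      tau11 n.+1 h i j z *: fvec n.+1 (dec (dec h i) j).
Proof.
have reg := reg_z.
rewrite (sum_tri_recr n (fun i j => tau11 n.+1 h i j z *: fvec n.+1 (dec (dec h i) j))).
rewrite big_ord_recr /= tau2_last.
have F2 i j : (i < n)%N -> (j < n)%N ->
    fvec n.+1 (dec (dec h i) j) = flast (h n) (dec (dec h i) j).
  by move=> ni nj; rewrite fvecS !dec_neq // neq_ltn ?ni ?nj orbT.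
have F1 j : (j < n)%N -> fvec n.+1 (dec (dec h n) j) = flast (h n).-1 (dec h j).
  by move=> nj; rewrite decC fvecS decE dec_neq ?flast_dec // neq_ltn nj orbT.
under eq_bigr => i _ do rewrite F2 // tau2S //.
under [X in _ = _ + (X + _)]eq_bigr => i _ do
  under eq_bigr => j ji do rewrite F2 // tau11S //.
under [X in _ = _ + (_ + X)]eq_bigr => j _ do rewrite F1 // tau11_last // last_rho1.
rewrite fvecS; have := h3 n; case hn: (h n) => [|[|[|//]]] _ /=.
- rewrite scale0r addr0 [X in _ = _ + (_ + X)]big1 ?addr0; last first.
    by move=> i _; rewrite mulr0 mul0r mulr0 scale0r.
  rewrite colop2_flast0 //; congr (_ + _); apply: eq_bigr => i _.
    by rewrite W0000 !phi_0 !mulr1.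
  by apply: eq_bigr => j _; rewrite W0000 !phi_0 !mulr1; reflexivity.
- by rewrite scale0r addr0 colop2_flast1 // [LHS]addrC -addrA.
- rewrite colop2_flast2 // fvecS !decE hn !flast_dec.
  by rewrite [RHS]addrACA [RHS]addrC.
Qed.
End Assemble.

Lemma action_step : action n.+1.
Proof.
by move=> h z h3 zo; split; [exact: action_step0|exact: action_step1|exact: action_step2].
Qed.
End Fix.

Lemma action_all n : rows_generic n -> action n.
Proof.
elim: n => [|n IHn] xo; last first.
  apply: action_step => //; apply: IHn => i ni.
  by case: (xo i (leqW ni)) => x0 X; split=> // j nj; apply: X; apply: leqW.
move=> h z _ _; split; rewrite /colop /= ?big_ord0 ?addr0 //.
by rewrite /lam big_ord0 scale1r.
Qed.

(** * Sum over paths *)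

(* Rows in states a and b, lowered by d and e respectively. *)
Definition pairw (a d b e : nat) (u v z : K) : K :=
  match d, e with
  | 0, 0 => 1
  | 1, 0 => phi a b u v
  | 0, 1 => phi b a v u
  | 1, 1 => chi a b u v z
  | 2, 0 => phi a b u v * phi a.-1 b u v
  | 0, 2 => phi b a v u * phi b.-1 a v u
  | _, _ => 0
  end.

Lemma pairwC a d b e u v z : pairw a d b e u v z = pairw b e a d v u z.
Proof. by case: d => [|[|[|d]]]; case: e => [|[|[|e]]] //=; apply: chiC. Qed.

Definition rowamp n (h d : nat -> nat) (z : K) : K :=
  \prod_(i < n) W (x i) z 0 (h i) (d i) (h i - d i)%N.
Definition pairamp n (h d : nat -> nat) (z : K) : K :=
  \prod_(i < n) \prod_(j < n | (i < j)%N) pairw (h i) (d i) (h j) (d j) (x i) (x j) z.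
Definition amp n h d z : K := rowamp n h d z * pairamp n h d z.

(** At a = 0 the truncated difference breaks conservation of the states, so the weight vanishes, as
    does [rho1 0]. *)
Lemma IKweight_rho1 a u z : indep u z -> W u z 0 a 1 (a - 1)%N = W u z 0 a 0 a * rho1 a u z.
Proof.
move=> /indep_nz[? ? ? ? _].
case: a => [|[|[|a]]]; rewrite /rho1 /IKweight ?mulr0 ?mul0r //=; field;
  exact/and4P || exact/and3P || exact/andP.
Qed.

Lemma IKweight_rho2 a u z : indep u z -> W u z 0 a 2 (a - 2)%N = W u z 0 a 0 a * rho2 a u z.
Proof.
move=> /indep_nz[? ? ? ? _].
case: a => [|[|[|a]]]; rewrite /rho2 /IKweight ?mulr0 ?mul0r //=; field;
  exact/and4P || exact/and3P || exact/andP.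
Qed.

Lemma pairampD1 n (h d : nat -> nat) z (i : nat) (P : pred nat) : (i < n)%N -> P i ->
  \prod_(k < n | P k) \prod_(l < n | P l && (k < l)%N)
    pairw (h k) (d k) (h l) (d l) (x k) (x l) z =
  \prod_(l < n | P l && (l != i :> nat)) pairw (h i) (d i) (h l) (d l) (x i) (x l) z *
  \prod_(k < n | P k && (k != i :> nat))
    \prod_(l < n | (P l && (l != i :> nat)) && (k < l)%N)
     pairw (h k) (d k) (h l) (d l) (x k) (x l) z.
Proof.
move=> ni Pi.
have bC (k l : nat) : k != l -> pairw (h k) (d k) (h l) (d l) (x k) (x l) z =
  pairw (h l) (d l) (h k) (d k) (x l) (x k) z by move=> _; apply: pairwC.
exact: (pairprodD1 bC ni Pi).
Qed.

Section Fix.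
Variables (n : nat) (h : nat -> nat) (z : K).
Hypotheses (zo : col_generic n z).
Let xz i : (i < n)%N -> indep (x i) z. Proof. exact: (proj2 zo). Qed.

Lemma amp0 : amp n h (fun=> 0%N) z = lam n h z.
Proof.
rewrite /amp /pairamp big1 ?mulr1 => [|i _]; last by rewrite big1.
by apply: eq_bigr => i _; rewrite subn0.
Qed.

Lemma amp1 i : (i < n)%N -> amp n h (unit_string i) z = tau1 n h i z.
Proof.
move=> ni; rewrite /amp /tau1; congr (_ * _).
  rewrite /rowamp /lam (bigD1 (Ordinal ni)) //= [in RHS](bigD1 (Ordinal ni)) //=.
  rewrite (_ : unit_string i i = 1%N); last by rewrite /unit_string eqxx.
  rewrite (IKweight_rho1 _ (xz ni)) mulrAC; congr (_ * _ * _); apply: eq_bigr => k ki.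
  by rewrite /unit_string (_ : (k == i :> nat) = false) ?subn0 //; apply: negPf.
rewrite /pairamp (pairampD1 h (unit_string i) z (P := xpredT) ni) //.
rewrite [X in _ * X]big1 ?mulr1; last first.
  move=> k ki; rewrite big1 // => l /andP[li _].
  by rewrite /unit_string (negPf ki) (negPf li).
by apply: eq_bigr => k ki; rewrite /unit_string eqxx (negPf ki).
Qed.

Lemma amp2 i : (i < n)%N -> amp n h (plusf (unit_string i) (unit_string i)) z = tau2 n h i z.
Proof.
move=> ni; rewrite /amp /tau2; congr (_ * _).
  rewrite /rowamp /lam (bigD1 (Ordinal ni)) //= [in RHS](bigD1 (Ordinal ni)) //=.
  rewrite (_ : plusf (unit_string i) (unit_string i) i = 2%N);
    last by rewrite /plusf /unit_string eqxx.
  rewrite (IKweight_rho2 _ (xz ni)) mulrAC; congr (_ * _ * _); apply: eq_bigr => k ki.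
  by rewrite /plusf /unit_string (_ : (k == i :> nat) = false) ?subn0 //; apply: negPf.
rewrite /pairamp (pairampD1 h (plusf (unit_string i) (unit_string i)) z (P := xpredT) ni) //.
rewrite [X in _ * X]big1 ?mulr1; last first.
  move=> k ki; rewrite big1 // => l /andP[li _].
  by rewrite /plusf /unit_string (negPf ki) (negPf li).
rewrite -big_split /=.
by apply: eq_bigr => k ki; rewrite /plusf /unit_string eqxx (negPf ki) decE dec_neq.
Qed.

Lemma amp11 i j : (i < n)%N -> (j < n)%N -> i != j ->
  amp n h (plusf (unit_string i) (unit_string j)) z = tau11 n h i j z.
Proof.
move=> ni nj ij; rewrite /amp /tau11.
have ii : plusf (unit_string i) (unit_string j) i = 1%N
  by rewrite /plusf /unit_string eqxx (negPf ij).
have jj : plusf (unit_string i) (unit_string j) j = 1%N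
  by rewrite /plusf /unit_string eqxx eq_sym (negPf ij).
have kk k : k != i -> k != j -> plusf (unit_string i) (unit_string j) k = 0%N.
  by move=> ki kj; rewrite /plusf /unit_string (negPf ki) (negPf kj).
have ji : j != i by rewrite eq_sym.
have -> : rowamp n h (plusf (unit_string i) (unit_string j)) z =
    lam n h z * (rho1 (h i) (x i) z * rho1 (h j) (x j) z).
  rewrite /rowamp /lam (bigD1 (Ordinal ni)) //= (bigD1 (Ordinal nj)) //=.
  rewrite [in RHS](bigD1 (Ordinal ni)) //= [in RHS](bigD1 (Ordinal nj)) //=.
  rewrite ii jj (IKweight_rho1 _ (xz ni)) (IKweight_rho1 _ (xz nj)).
  rewrite (eq_bigr (fun k : 'I_n => W (x k) z 0 (h k) 0 (h k))); first by ring.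
  by move=> k; rewrite -!val_eqE /= => /andP[ki kj]; rewrite kk ?subn0.
have -> : pairamp n h (plusf (unit_string i) (unit_string j)) z =
  chi (h i) (h j) (x i) (x j) z * Phi2 n h i j.
  rewrite /pairamp (pairampD1 h _ z (P := xpredT) ni) //.
  rewrite (pairampD1 h _ z (P := fun k => true && (k != i)) nj) //.
  rewrite [X in _ * (_ * X)]big1 ?mulr1; last first.
    move=> k /andP[ki kj]; rewrite big1 // => l /andP[/andP[li lj] _].
    by rewrite !kk.
  rewrite (bigD1 (Ordinal nj)) //= {1}ii {1}jj -mulrA; congr (_ * _).
  rewrite -big_split /=; apply: eq_bigr => k; rewrite -!val_eqE /= => /andP[ki kj].
  by rewrite ii jj kk.
by rewrite /rho11; ring.
Qed.
End Fix.

Arguments tri : simpl never.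

Lemma minusf0 h : minusf h (fun=> 0%N) = h.
Proof. by apply: funext => k; rewrite /minusf subn0. Qed.
Lemma minusf_unit h i : minusf h (unit_string i) = dec h i.
Proof.
by apply: funext => k; rewrite /minusf /unit_string /dec; case: eqP => _; rewrite ?subn1 ?subn0.
Qed.

Lemma minusf_add h d e : minusf h (plusf d e) = minusf (minusf h d) e.
Proof. by apply: funext => k; rewrite /minusf /plusf subnDA. Qed.

Lemma colop_fvec n s h z : rows_generic n -> (forall k, (h k < 3)%N) -> col_generic n z ->
  (s < 3)%N ->
  colop s z (fvec n h) =
  dsum s n (fun d => amp n h d z *: fvec n (minusf h d)).
Proof.
move=> xo h3 zo; have [A0 A1 A2] := action_all xo h3 zo.
case: s => [|[|[|]]] // _.
- by rewrite dsum0 amp0 minusf0.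
- rewrite dsum1 A1; apply: eq_bigr => i _.
  by rewrite amp1 // minusf_unit.
- rewrite dsum2 A2; congr (_ + _); apply: eq_bigr => i _.
    by rewrite amp2 // minusf_add !minusf_unit.
  apply: eq_bigr => j ji; rewrite amp11 ?minusf_add ?minusf_unit //.
  by rewrite neq_ltn ji orbT.
Qed.

Fixpoint ev n (g : nat -> nat) : colsp n -> K^o :=
  match n return colsp n -> K^o with
  | 0 => fun v => v
  | m.+1 => fun v => ev g (part (g m) v)
  end.

Lemma ev_is_linear n g : linear (@ev n g).
Proof. by elim: n => // n IH a u v; rewrite /= partP IH. Qed.
HB.instance Definition _ n g :=
  GRing.isLinear.Build K (colsp n) K^o *:%R (@ev n g) (@ev_is_linear n g).

Fixpoint run n L (S : nat -> nat) (z : nat -> K) : colsp n -> colsp n :=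
  if L is l.+1 then fun v => run l (fun c => S c.+1) (fun c => z c.+1) (colop (S 0) (z 0) v)
  else id.

Lemma run_is_linear n L S z : linear (@run n L S z).
Proof. by elim: L S z => // L IH S z a u v; rewrite /= linearP IH. Qed.
HB.instance Definition _ n L S z :=
  GRing.isLinear.Build K (colsp n) (colsp n) *:%R (@run n L S z) (@run_is_linear n L S z).

Lemma ev_local n g g' v : (forall k, (k < n)%N -> g k = g' k) -> @ev n g v = ev g' v.
Proof.
elim: n v => //= n IH v E; rewrite E // IH // => k kn.
by apply: E; apply: leqW.
Qed.

Lemma colw_local n s z g h g' h' :
  (forall k, (k < n)%N -> g k = g' k) -> (forall k, (k < n)%N -> h k = h' k) ->
  colw x n s z g h = colw x n s z g' h'.
Proof.
elim: n s => //= n IH s E E'; apply: eq_bigr => k _; rewrite E // E' //.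
by rewrite IH // => l ln; [apply: E|apply: E']; apply: leqW.
Qed.

Lemma ev_colop n s z (v : colsp n) h : (forall k, (h k < 3)%N) ->
  ev h (colop s z v) = fsum n (fun g => ev g v * colw x n s z g h).
Proof.
elim: n s v h => [|n IH] s v h h3.
  by rewrite /= /colop; case: eqP => _; rewrite ?mulr1 ?mulr0.
rewrite [LHS]/= part_col // linear_sum /=.
under eq_bigr => k _.
  rewrite linear_sum /=; under eq_bigr => j _ do rewrite linearZ /= IH // -[_ *: _]/(_ * _).
  over.
rewrite exchange_big /=; apply: eq_bigr => j _.
under eq_bigr => k _ do rewrite -fsumMl.
rewrite -fsum_sum; apply: eq_fsum => g _.
have uE : upd g n j n = j by rewrite /upd eqxx.
have uN k : (k < n)%N -> upd g n j k = g k by move=> kn; rewrite /upd ltn_eqF.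
rewrite uE (ev_local _ uN) mulr_sumr; apply: eq_bigr => k _.
rewrite (colw_local _ _ uN (fun _ _ => erefl)).
by rewrite mulrC -mulrA.
Qed.

Lemma Zf_ev N L S z v :
  fsum N (fun g => ev g v * Zf x N L S z g) = ev (fun=> 0%N) (@run N L S z v).
Proof.
elim: L S z v => [|L IH] S z v /=.
  under eq_fsum do rewrite mulrC.
  by rewrite fsum_pick.
rewrite -IH.
transitivity (fsum N (fun g => fsum N (fun g' => ev g v * (colw x N (S 0%N) (z 0%N) g g' *
    Zf x N L (fun c => S c.+1) (fun c => z c.+1) g')))).
  by apply: eq_fsum => g _; rewrite fsumMl.
rewrite fsum_exch; apply: eq_fsum => g' [g3 _]; rewrite ev_colop // -fsumMr.
by apply: eq_fsum => g _; rewrite mulrA.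
Qed.

(** Only vectors of type f_{h,2} enter, and these have the single component |2> on the new row. *)
Lemma ev_twos N g : (forall k, (g k < 3)%N) ->
  ev g (fvec N (twos N)) = (agree N g (twos N))%:R.
Proof.
move=> g3; suff H n h : (forall k, (k < n)%N -> h k = 2%N) ->
    ev g (fvec n h) = (agree n g h)%:R.
  by apply: H => k kN; rewrite /twos kN.
elim: n h => [|n IH] h h2; first by rewrite (_ : agree 0 _ _) //; apply/agreeP.
have {}IH : ev g (fvec n h) = (agree n g h)%:R by apply: IH => k kn; apply/h2/leqW.
rewrite agreeS h2 // /fvec -/fvec [ev _ _]/= part_tri // h2 //.
by case: (g n) (g3 n) => [|[|[|//]]] _; rewrite /fcomp ?linear0 ?IH.
Qed.

(** f_{h,1} and f_{h,2} have no component along 0 on the new row. That of f_{h,0} is T_0(x n) f_h, a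
    multiple of f_h by an eigenvalue that is 1 at h = 0. *)
Lemma ev0 n h : rows_generic n -> (forall k, (h k < 3)%N) ->
  ev (fun=> 0%N) (fvec n h) = (agree n h (fun=> 0%N))%:R.
Proof.
elim: n => [|n IH] xo h3; first by rewrite (_ : agree 0 _ _) //; apply/agreeP.
have xo' : rows_generic n.
  move=> i ni; case: (xo i (leqW ni)) => x0 H; split=> // j nj; apply: H; exact: leqW.
rewrite agreeS /fvec -/fvec [ev _ _]/= part_tri //.
case: (h n) => [|[|m]]; rewrite /fcomp ?linear0 //=.
have [-> _ _] := action_all xo' h3 (rows_generic_last xo).
rewrite linearZ /= IH //; case: agreeP => [h0|_]; last by rewrite scaler0.
rewrite /lam big1 ?scale1r // => i _; by rewrite h0.
Qed.

(** The states before column c. The subtraction truncates, but a path that lowers a row too far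
    meets a weight violating conservation and contributes 0. *)
Definition minusm (h : nat -> nat) (D : nat -> nat -> nat) (c : nat) : nat -> nat :=
  fun k => (h k - \sum_(c' < c) D c' k)%N.

Lemma minusm0 h D : minusm h D 0 = h.
Proof. by apply: funext => k; rewrite /minusm big_ord0 subn0. Qed.
Lemma minusmS h d M c : minusm h (ccons d M) c.+1 = minusm (minusf h d) M c.
Proof. by apply: funext => k; rewrite /minusm /minusf big_ord_recl subnDA. Qed.

Lemma ev_run N L S z h : rows_generic N -> (forall k, (h k < 3)%N) ->
  (forall c, (S c < 3)%N) -> (forall c, col_generic N (z c)) ->
  ev (fun=> 0%N) (@run N L S z (fvec N h)) =
  mxsum N L (fun D => (\prod_(c < L) ((\sum_(k < N) D c k == S c)%N%:R
       * amp N (minusm h D c) (D c) (z c)))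
    * (agree N (minusm h D L) (fun=> 0%N))%:R).
Proof.
elim: L S z h => [|L IH] S z h xo h3 S3 zo.
  by rewrite /= big_ord0 mul1r minusm0 ev0.
change (run _ _ _ _) with (run L (fun c => S c.+1) (fun c => z c.+1)
  (colop (S 0%N) (z 0%N) (fvec N h))).
rewrite colop_fvec // /dsum.
rewrite (fsum_linear (@run N L (fun c => S c.+1) (fun c => z c.+1))) fsum_linear.
rewrite [RHS]/=; apply: eq_fsum => d _.
transitivity (((\sum_(k < N) d k == S 0)%N%:R * amp N h d (z 0%N)) *
   ev (fun=> 0%N) (run L (fun c => S c.+1) (fun c => z c.+1) (fvec N (minusf h d)))).
  case: eqP => _; last by rewrite !linear0 !mul0r.
  by rewrite !linearZ /= mul1r.
rewrite IH //; last by move=> k; apply: leq_ltn_trans (leq_subr _ _) (h3 k).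
rewrite -mxsumMl; apply: eq_mxsum => M _; rewrite big_ord_recl mulrA minusm0 minusmS.
congr (_ * _ * _).
by apply: eq_bigr => c _; rewrite /= minusmS.
Qed.

Lemma IKF_path N L S z : rows_generic N -> (forall c, (S c < 3)%N) ->
    (forall c, col_generic N (z c)) ->
  Zf x N L S z (twos N) =
  mxsum N L (fun D => (\prod_(c < L) ((\sum_(k < N) D c k == S c)%N%:R
       * amp N (minusm (twos N) D c) (D c) (z c)))
    * (agree N (minusm (twos N) D L) (fun=> 0%N))%:R).
Proof.
move=> xo S3 zo; have [t3 _] := twos_small N.
rewrite -ev_run // -Zf_ev -[LHS](fsum_pick _ (twos_small N)).
by apply: eq_fsum => g [g3 _]; rewrite ev_twos.
Qed.
End Rows.

(** * The pair factors multiply to Delta *)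

Section Pair.
Variable z : nat -> K.

(* For U = e_a + e_b, with a = b allowed: the state of the row before column k,
   and the amount by which it is lowered there. *)
Definition occ (a b k : nat) : nat := ((k <= a) + (k <= b))%N.

Definition hits (a b k : nat) : nat := ((k == a) + (k == b))%N.

Definition pairprod L (a b c d : nat) (u v : K) : K :=
  \prod_(k < L) pairw (occ a b k) (hits a b k) (occ c d k) (hits c d k) u v (z k).

Lemma pairprodC L a b c d u v : pairprod L a b c d u v = pairprod L c d a b v u.
Proof. by apply: eq_bigr => k _; apply: pairwC. Qed.

Ltac cmp := repeat match goal with
  | |- context [leq ?m ?n] => first [rewrite (_ : leq m n = true); [|lia]
    | rewrite (_ : leq m n = false); [|lia]]
  | |- context [@eq_op _ ?m ?n] =>
    first [rewrite (_ : (m == n :> nat) = true); [|lia]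
    | rewrite (_ : (m == n :> nat) = false); [|lia]]
  end.

Ltac usingseq s := rewrite /pairprod (@prod_supp _ _ s
   (fun k => pairw (occ _ _ k) (hits _ _ k) (occ _ _ k) (hits _ _ k) _ _ (z k)));
  [ rewrite !big_cons big_nil /occ /hits; cmp; rewrite /pairw /=
  | rewrite /= !inE; lia | rewrite /=; lia
  | let k := fresh "k" in let H := fresh "H" in intros k; rewrite !inE !negb_or; intros H;
    rewrite /hits /pairw;
    repeat match goal with |- context [@eq_op _ ?m ?n] =>
      rewrite (_ : (m == n :> nat) = false); [|lia] end;
    reflexivity ].

Ltac fin H z0 a b := nz H; nz (indep_sym H); have := z0 a; have := z0 b; have := oner_neq0 K;
  case: Q => ? ? ? ? ? ?; rewrite /phi /chi; field; repeat (apply/andP; split); assumption.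

(** A column where neither row is lowered contributes 1, so only the columns a, b, c, d matter.
    Coinciding positions are merged first, which leaves at most four factors in each case. *)
Lemma pairprod_explicit L a b c d u v w : (a <= b < L)%N -> (c <= d < L)%N ->
  u != 0 -> v != 0 -> indep u v -> (forall k, z k != 0) ->
  Delta_explicit q z (a, b) (c, d) u v = Some w -> pairprod L a b c d u v = w.
Proof.
move=> ab cd u0 v0 uv z0.
rewrite /Delta_explicit; case: ifP => C1; last case: ifP => C2; last case: ifP => C3;
 last case: ifP => C4; last case: ifP => C5; last case: ifP => C6; last case: ifP => C7 //.
all: case=> <-.
- case: (ltnP a b) => ab'; case: (ltnP c d) => cd'.
  + usingseq [:: a; b; c; d]. fin uv z0 a b.
  + have E : c = d by lia. subst d. usingseq [:: a; b; c]. fin uv z0 a b.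
  + have E : a = b by lia. subst b. usingseq [:: a; c; d]. fin uv z0 a a.
  + have E : a = b by lia. subst b. have E : c = d by lia. subst d. usingseq [:: a; c].
    fin uv z0 a a.
- case: (ltnP c d) => cd'.
  + usingseq [:: a; b; c; d]. fin uv z0 a b.
  + have E : c = d by lia. subst d. usingseq [:: a; b; c]. fin uv z0 a b.
- usingseq [:: a; b; c; d]. fin uv z0 a b.
- have E : c = a by lia. subst c. usingseq [:: a; b; d]. fin uv z0 a b.
- have E : c = b by lia. subst c. usingseq [:: a; b; d]. fin uv z0 a b.
- have E : d = b by lia. subst d. usingseq [:: a; b; c]. fin uv z0 a b.
- have E : c = a by lia. subst c. have E : d = b by lia. subst d. usingseq [:: a; b].
  fin uv z0 a b.
Qed.
End Pair.

Lemma Delta_pairprod L (z : nat -> K) (U V : nat -> nat) u v :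
    supported L U -> (\sum_(c < L) U c = 2)%N ->
    supported L V -> (\sum_(c < L) V c = 2)%N -> (forall c, (U c + V c <= 2)%N) ->
    u != 0 -> v != 0 -> indep u v -> (forall k, z k != 0) ->
  \prod_(c < L) pairw (2 - \sum_(c' < c) U c')%N (U c) (2 - \sum_(c' < c) V c')%N (V c)
    u v (z c)
  = Delta q z U V u v.
Proof.
move=> sU U2 sV V2 UV u0 v0 uv z0.
have [a [b [ab UE]]] := string_positions sU U2.
have [c [d [cd VE]]] := string_positions sV V2.
have occE a' b' k : (2 - \sum_(c' < k) (unit_string a' c' + unit_string b' c'))%N = occ a' b' k.
  by rewrite big_split /= !sum_unit /occ; lia.
rewrite /Delta UE VE !positionsE; [|lia|lia].
transitivity (pairprod z L a b c d u v).
  by apply: eq_bigr => k _; rewrite !occE.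
case E: (Delta_explicit q z (a, b) (c, d) u v) => [w|]; first exact: pairprod_explicit E.
rewrite pairprodC; case E': (Delta_explicit q z (c, d) (a, b) v u) => [w|].
  by apply: pairprod_explicit E' => //; apply: indep_sym.
exfalso; have := UV a; have := UV b; have := UV c; have := UV d.
rewrite UE VE /unit_string => Hd Hc Hb Ha.
case/andP: ab => ab _; case/andP: cd => cd _.
exact: (explicit_total ab cd Ha Hb Hc Hd (explicit_None E) (explicit_None E')).
Qed.

Lemma IKweight_cons (u v : K) i j k l : (i + j != k + l)%N -> W u v i j k l = 0.
Proof.
by case: i => [|[|[|i]]]; case: j => [|[|[|j]]] //; case: k => [|[|[|k]]] //;
  case: l => [|[|[|l]]].
Qed.

Lemma colw1 (x : nat -> K) s t g g' : colw x 1 s t g g' = W (x 0%N) t 0 (g 0%N) s (g' 0%N).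
Proof.
by rewrite /= !big_ord_recl big_ord0 /= mul1r !mul0r !addr0.
Qed.

(** With one row, conservation determines every horizontal state, so a single configuration
    survives. *)
Lemma Zf1 L (U : nat -> nat) (x z : nat -> K) g : (g 0 < 3)%N -> g 0 = (\sum_(c < L) U c)%N ->
  Zf x 1 L U z g = \prod_(c < L) W (x 0) (z c) 0 (g 0 - \sum_(c' < c) U c')%N (U c)
     (g 0 - \sum_(c' < c) U c' - U c)%N.
Proof.
elim: L U z g => [|L IH] U z g g3 gE.
  rewrite /= big_ord0 (_ : agree 1 g _) //; apply/agreeP => -[|k] // _.
  by rewrite gE big_ord0.
rewrite big_ord_recl in gE.
have jl : (g 0 - U 0 < 3)%N by apply: leq_ltn_trans (leq_subr _ _) g3.
transitivity (\sum_(j < 3) colw x 1 (U 0%N) (z 0%N) g (upd (fun=> 0%N) 0 j)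
   * Zf x 1 L (fun c => U c.+1) (fun c => z c.+1) (upd (fun=> 0%N) 0 j)); first by [].
transitivity (\sum_(j < 3) W (x 0%N) (z 0%N) 0 (g 0%N) (U 0%N) j
   * Zf x 1 L (fun c => U c.+1) (fun c => z c.+1) (upd (fun=> 0%N) 0 j)).
  by apply: eq_bigr => j _; rewrite colw1.
rewrite (bigD1 (Ordinal jl)) //= [X in _ + X]big1 ?addr0; last first.
  move=> j; rewrite -val_eqE /= => jn; rewrite IKweight_cons ?mul0r //.
  by apply: contraNneq jn => E; apply/eqP; lia.
rewrite IH /upd ?eqxx //; last by rewrite gE addKn.
rewrite big_ord_recl big_ord0 subn0; congr (_ * _); apply: eq_bigr => c _.
by rewrite big_ord_recl !subnDA.
Qed.

Lemma extendE N (x : 'I_N -> K) (i : 'I_N) : extend x i = x i.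
Proof. by rewrite /extend valK. Qed.

Lemma IKF_row L (U : nat -> nat) u (z : nat -> K) :
    (forall c, (U c < 3)%N) -> (\sum_(c < L) U c = 2)%N ->
  IKF q L U (fun _ : 'I_1 => u) z =
  \prod_(c < L) W u (z c) 0 (2 - \sum_(c' < c) U c')%N (U c) (2 - \sum_(c' < c) U c' - U c)%N.
Proof.
move=> U3 U2; rewrite IKF_Zf // Zf1 //.
by have -> : extend (fun _ : 'I_1 => u) 0 = u by apply: (extendE _ ord0).
Qed.

(** * Paths and 2-permutation matrices *)

Section Main.
Variables (N L : nat) (S : nat -> nat) (x : 'I_N -> K) (z : nat -> K).
Let xe := extend x.
Hypotheses (xo : rows_generic xe N) (zo : forall c, col_generic xe N (z c)).
Hypotheses (S3 : forall c, (S c < 3)%N) (sS : supported L S).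
Hypothesis (S2 : (\sum_(c < L) S c = 2 * N)%N).

Definition rhs_term (s : 'I_N -> nat -> nat) : K :=
  (\prod_(i < N) \prod_(j < N | (i < j)%N) Delta q z (s i) (s j) (x i) (x j))
  * \prod_(i < N) IKF q L (s i) (fun _ : 'I_1 => x i) z.

Definition rows (M : nat -> nat -> nat) : 'I_N -> nat -> nat := fun i c => M c i.

Lemma path_term (M : nat -> nat -> nat) : msmall N L M ->
  (\prod_(c < L) ((\sum_(k < N) M c k == S c)%N%:R
       * amp xe N (minusm (twos N) M c) (M c) (z c)))
    * (agree N (minusm (twos N) M L) (fun=> 0%N))%:R =
  if rows M \in two_perm_mx N S then rhs_term (rows M) else 0.
Proof.
move=> [Ms M0]; case: ifPn => [|nM].
  rewrite inE => -[rowM colM].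
  have row2 (i : 'I_N) : (\sum_(c < L) M c i = 2)%N.
    apply: (@sums_toE L (fun c => M c i)); last exact: rowM.
    by move=> c Lc; apply: M0.
  have -> : agree N (minusm (twos N) M L) (fun=> 0%N).
    apply/agreeP => k kN; rewrite /minusm (row2 (Ordinal kN)) /twos kN //.
  rewrite mulr1.
  transitivity (\prod_(c < L) amp xe N (minusm (twos N) M c) (M c) (z c)).
    by apply: eq_bigr => c _; rewrite colM eqxx mul1r.
  have mE c (i : 'I_N) : minusm (twos N) M c i = (2 - \sum_(c' < c) M c' i)%N.
    by rewrite /minusm /twos ltn_ord.
  have xE (i : 'I_N) : xe i = x i by rewrite /xe /extend valK.
  rewrite big_split /= mulrC /rhs_term; congr (_ * _).
    rewrite /pairamp exchange_big /=; apply: eq_bigr => i _.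
    rewrite exchange_big /=; apply: eq_bigr => j ij.
    have [xi0 xi] := xo (ltn_ord i); have [xj0 _] := xo (ltn_ord j).
    rewrite -(@Delta_pairprod L) ?row2 //.
    - by apply: eq_bigr => c _; rewrite !mE !xE.
    - by move=> c Lc; apply: M0.
    - by move=> c Lc; apply: M0.
    - move=> c; have := colM c; have := S3 c; rewrite (bigD1 i) //= (bigD1 j) /=; last first.
        by rewrite -val_eqE /= neq_ltn ij orbT.
      by rewrite /rows; lia.
    - by rewrite -xE.
    - by rewrite -xE.
    - by rewrite -!xE; apply: xi => //; rewrite neq_ltn ij.
    - by move=> c; case: (zo c).
  rewrite /rowamp exchange_big /=; apply: eq_bigr => i _.
  have U3 c : (rows M i c < 3)%N by case: (Ms c) => H _; apply: H.
  rewrite IKF_row ?row2 //.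
  by apply: eq_bigr => c _; rewrite !mE xE.
apply/eqP; apply: contraNT nM; rewrite mulf_eq0 negb_or => /andP[P0 A0].
rewrite inE.
have {}A0 : agree N (minusm (twos N) M L) (fun=> 0%N).
  by case: agree A0 => //; rewrite eqxx.
have colM c : (\sum_(i < N) M c i = S c)%N.
  case: (ltnP c L) => cL; last first.
    by rewrite sS // big1 // => i _; apply: M0.
  move/prodf_neq0: P0 => /(_ (Ordinal cL) isT) /=.
  by case: (_ =P S c) => //= _; rewrite mul0r eqxx.
(* Ending in state 0 gives only a lower bound on the row sums, because of the truncated subtraction.
   The total 2N, known from the column sums, forces equality in every row. *)
have ge2 (i : 'I_N) : (2 <= \sum_(c < L) M c i)%N.
  by have := agreeP _ _ _ A0 i (ltn_ord i); rewrite /minusm /twos ltn_ord; lia.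
have tot : (\sum_(i < N) \sum_(c < L) M c i = \sum_(i < N) 2)%N.
  rewrite exchange_big sum_nat_const card_ord mulnC -S2.
  by apply: eq_bigr => c _; rewrite colM.
split=> // i; exists L; first by move=> c Lc; apply: M0.
have [_ /esym] := leqif_sum (fun (i : 'I_N) (_ : true) => leqif_eq (ge2 i)).
by rewrite -tot eqxx => /forallP/(_ i)/eqP.
Qed.

(** The entries of a 2-permutation matrix are bounded by those of S, so they are below 3 and vanish
    beyond column L. The set is thus covered by the finite type of N x L matrices over {0, 1, 2}. *)
Lemma two_perm_sum :
  (\sum_(s \in two_perm_mx N S) rhs_term s)%R =
  mxsum N L (fun M => if rows M \in two_perm_mx N S then rhs_term (rows M) else 0).
Proof.
rewrite -sum_mx -big_mkcond /=.
pose r := [seq rows (mfun h) | h <- enum {: 'M['I_3]_(N, L)}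
  & rows (mfun h) \in two_perm_mx N S].
rewrite (fsbigE r) /=; last 3 first.
- rewrite map_inj_uniq ?filter_uniq -?enumT ?enum_uniq // => h h' E.
  apply/matrixP => i j; apply: val_inj.
  by have := congr1 (fun f => f i (nat_of_ord j)) E; rewrite /rows !mfunE.
- by move=> s /= /mapP[h]; rewrite mem_filter => /andP[/set_mem hA _] ->.
- move=> s sA; case/negP; apply/mapP.
  have [rowS colS] := sA.
  have sle (i : 'I_N) c : (s i c <= S c)%N by rewrite -colS (bigD1 i) //= leq_addr.
  pose h : 'M['I_3]_(N, L) := \matrix_(i, j) inord (s i j).
  have hE : s = rows (mfun h).
    apply: funext => i; apply: funext => c; rewrite /rows.
    case: (ltnP c L) => cL.
      rewrite -[c]/(nat_of_ord (Ordinal cL)) mfunE mxE inordK //.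
      exact: leq_ltn_trans (sle i c) (S3 c).
    have s0 : s i c = 0%N by apply/eqP; rewrite -leqn0 -(sS cL); apply: sle.
    rewrite s0 /mfun; case: insubP => // i' _ _.
    by rewrite insubF // ltnNge cL.
  exists h => //; rewrite mem_filter mem_enum -hE andbT.
  exact: mem_set.
by rewrite /r big_map big_filter_cond big_enum_cond; apply: eq_bigl => h; rewrite /= andbb.
Qed.

Lemma IKF_formula : IKF q L S x z = \sum_(s \in two_perm_mx N S) rhs_term s.
Proof.
rewrite two_perm_sum IKF_Zf // IKF_path //; apply: eq_mxsum => M Ms.
exact: path_term.
Qed.
End Main.

End IK.

(** * Genericity *)

Section Generic.
Variables (K : fieldType) (s : seq K).
Hypothesis ind : alg_independent s.
Local Notation m := (size s).

(** One integer point with nonzero value shows that p is not the zero polynomial; each genericity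
    condition below is obtained by choosing such a point. *)
Lemma independent_neq0 (p : {mpoly int[m]}) (v : 'I_m -> int) : p.@[v] != 0 ->
  (map_mpoly (fun n : int => n%:~R : K) p).@[fun i => s`_i] != 0.
Proof. by move=> pv; apply: ind; apply: contraNneq pv => ->; rewrite meval0. Qed.

Lemma independent_nz (i : 'I_m) : s`_i != 0.
Proof.
have := @independent_neq0 'X_i (fun=> 1); rewrite mevalXU oner_neq0 => /(_ isT).
by rewrite map_mpolyX mevalXU.
Qed.

Lemma independent_1B (i : 'I_m) k : 1 - s`_i ^+ k.+1 != 0.
Proof.
have := @independent_neq0 (1 - 'X_i ^+ k.+1) (fun=> 0).
rewrite mevalB meval1 rmorphXn /= mevalXU expr0n subr0 oner_neq0 => /(_ isT).
by rewrite rmorphB rmorph1 rmorphXn /= map_mpolyX mevalB meval1 rmorphXn /= mevalXU.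
Qed.

Lemma independent_B (i j l : 'I_m) k : i != j -> i != l -> s`_i - s`_j ^+ k * s`_l != 0.
Proof.
move=> ij il; have := @independent_neq0 ('X_i - 'X_j ^+ k * 'X_l) (fun n => (n == i)%:R).
rewrite mevalB mevalM rmorphXn /= !mevalXU eqxx [l == i]eq_sym (negPf il) mulr0 subr0.
rewrite oner_neq0 => /(_ isT).
by rewrite rmorphB rmorphM rmorphXn /= !map_mpolyX mevalB mevalM rmorphXn /= !mevalXU.
Qed.
End Generic.

Section GenericConsequences.
Variables (K : fieldType) (N : nat) (q : K) (x : 'I_N -> K) (z : nat -> K).
Hypothesis gen : generic q x z.

Lemma generic_qgeneric : qgeneric q.
Proof.
have g0 := @gen 0%N; have i0 : 'I_(size (q :: codom x ++ mkseq z 0)) := ord0.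
split; first exact: (independent_nz g0 ord0).
  by have := independent_1B g0 ord0 0; rewrite expr1.
exact: (independent_1B g0 ord0 1).
Qed.

Local Notation fam L := (q :: codom x ++ mkseq z L).

Lemma fam_x L (i : 'I_N) : (i.+1 < size (fam L))%N /\ (fam L)`_(i.+1) = x i.
Proof.
split; first by rewrite /= size_cat size_codom card_ord ltnS ltn_addr.
rewrite /= nth_cat size_codom card_ord ltn_ord.
by rewrite (nth_map i) ?size_enum_ord // nth_ord_enum.
Qed.

Lemma fam_z c : ((N + c).+1 < size (fam c.+1))%N /\ (fam c.+1)`_((N + c).+1) = z c.
Proof.
split; first by rewrite /= size_cat size_codom card_ord size_mkseq ltnS ltn_add2l.
by rewrite /= nth_cat size_codom card_ord ltnNge leq_addr addKn nth_mkseq.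
Qed.

Lemma fam_indep L a b : (a.+1 < size (fam L))%N -> (b.+1 < size (fam L))%N -> a != b ->
  indep q (fam L)`_a.+1 (fam L)`_b.+1.
Proof.
move=> al bl ab k; have g := @gen L; apply/andP; split.
  (* Index 0 of the family is q. *)
  exact: (independent_B g (i := Ordinal al) (j := ord0) (l := Ordinal bl)).
by apply: (independent_B g (i := Ordinal bl) (j := ord0) (l := Ordinal al)); rewrite // eq_sym.
Qed.

Lemma generic_rows : rows_generic q (extend x) N.
Proof.
move=> i iN; have [s1 e1] := fam_x 0%N (Ordinal iN).
have E k (kN : (k < N)%N) : extend x k = x (Ordinal kN) by apply: (extendE x (Ordinal kN)).
rewrite (E i iN) -e1; split.
  exact: (independent_nz (@gen 0%N) (Ordinal s1)).
by move=> j jN ij; have [s2 e2] := fam_x 0%N (Ordinal jN); rewrite (E j jN) -e2;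
  apply: fam_indep.
Qed.

Lemma generic_col c : col_generic q (extend x) N (z c).
Proof.
have [s1 e1] := fam_z c; rewrite -e1; split.
  exact: (independent_nz (@gen c.+1) (Ordinal s1)).
move=> i iN; have [s2 e2] := fam_x c.+1 (Ordinal iN).
rewrite (extendE x (Ordinal iN)) -e2; apply: fam_indep => //.
by rewrite neq_ltn ltn_addr.
Qed.
End GenericConsequences.

Theorem theorem1p8p4 (K : fieldType) (N : nat) (S : nat -> nat) (L : nat)
    (q : K) (x : 'I_N -> K) (z : nat -> K) :
  (1 <= N)%N ->
  two_string S -> sums_to S (2 * N)%N -> supported L S ->
  generic q x z ->
  IKF q L S x z =
    \sum_(sigma \in two_perm_mx N S)
      ((\prod_(i < N) \prod_(j < N | (i < j)%N)
          Delta q z (sigma i) (sigma j) (x i) (x j))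
       * \prod_(i < N) IKF q L (sigma i) (fun _ : 'I_1 => x i) z).
Proof.
move=> _ [S2 _] S2N sS gen.
apply: (IKF_formula (generic_qgeneric gen) (generic_rows gen)) => //.
- exact: generic_col.
- exact: sums_toE.
Qed.
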